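(* (In Zermelo-Fraenkel set theory ZF, without assuming the Axiom of Choice.) Let $R$ be a domain and assume that for every set of variables $X$ and any multiplicative subset $S$ of the polynomial ring $R[X]$ with $0\notin S$, the localization $S^{-1}R[X]$ has a maximal ideal. Then the Axiom of Choice holds: for every family $(A_i)_{i\in I}$ of non-empty sets there exists a function $f:I\to\bigcup_{i\in I}A_i$ such that $f(i)\in A_i$ for each $i\in I$.
   Context: The ambient theory is ZF; the statement is a theorem of ZF. Rings are associative with a unit. A domain is a nontrivial commutative ring without zero-divisors. For a (possibly infinite) set $X$, $R[X]$ denotes the commutative polynomial ring over $R$ whose variables are the elements of $X$. A multiplicative subset of a commutative ring is a subset containing $1$ and closed under multiplication. *)

(* Defs.v *)
From Stdlib Require Import ClassicalEpsilon.

Set Implicit Arguments.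

(** "A theorem of ZF" is rendered as "true in every model of ZF".  Separation
    and Replacement are schemas over syntactic first-order formulas (de Bruijn
    indices, with parameters).  Quantifying instead over all predicates
    [M -> Prop] would give second-order ZF, whose models inherit choice
    principles of the metatheory. *)

Inductive form : Type :=
| FMem (i j : nat)
| FEq (i j : nat)
| FBot
| FAnd (p q : form)
| FOr (p q : form)
| FImp (p q : form)
| FAll (p : form)
| FEx (p : form).

Definition scons {V : Type} (x : V) (e : nat -> V) (n : nat) : V :=
  match n with O => x | S k => e k end.

Fixpoint sat (V : Type) (mem : V -> V -> Prop) (e : nat -> V) (p : form) : Prop :=
  match p with
  | FMem i j => mem (e i) (e j)
  | FEq i j => e i = e j
  | FBot => False
  | FAnd p q => sat mem e p /\ sat mem e q
  | FOr p q => sat mem e p \/ sat mem e q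
  | FImp p q => sat mem e p -> sat mem e q
  | FAll p => forall x : V, sat mem (scons x e) p
  | FEx p => exists x : V, sat mem (scons x e) p
  end.

Record is_ZF (V : Type) (mem : V -> V -> Prop) : Prop := {
  zf_ext : forall a b, (forall x, mem x a <-> mem x b) -> a = b;
  zf_found : forall a, (exists x, mem x a) ->
    exists x, mem x a /\ forall y, mem y x -> ~ mem y a;
  zf_pair : forall a b, exists c, forall x, mem x c <-> x = a \/ x = b;
  zf_union : forall a, exists c, forall x,
    mem x c <-> exists y, mem y a /\ mem x y;
  zf_power : forall a, exists c, forall x,
    mem x c <-> (forall y, mem y x -> mem y a);
  zf_inf : exists w,
    (exists z, mem z w /\ forall x, ~ mem x z) /\
    (forall x, mem x w ->
       exists y, mem y w /\ forall z, mem z y <-> mem z x \/ z = x);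
  zf_sep : forall (p : form) (e : nat -> V) (a : V),
    exists c, forall x, mem x c <-> mem x a /\ sat mem (scons x e) p;
  zf_repl : forall (p : form) (e : nat -> V) (a : V),
    (forall x, mem x a -> forall y y',
       sat mem (scons x (scons y e)) p ->
       sat mem (scons x (scons y' e)) p -> y = y') ->
    exists c, forall y,
      mem y c <-> exists x, mem x a /\ sat mem (scons x (scons y e)) p
}.

Record ZF_model : Type := {
  universe :> Type;
  mem : universe -> universe -> Prop;
  mem_is_ZF : is_ZF mem
}.

Arguments mem {_} _ _.
Notation "x ∈ y" := (mem x y) (at level 70, no associativity).

Lemma ZF_model_inhabited (M : ZF_model) : inhabited M.
Proof. destruct (zf_inf (mem_is_ZF M)) as [w _]. exact (inhabits w). Qed.

(** Everything below is the usual set-theoretic definition with quantifiers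
    ranging over [M]; in particular finiteness, numbers, functions and
    polynomials are those of [M], which may be non-standard.

    [the P] is definite description: the element of [M] satisfying [P] when it
    is unique, and a junk value otherwise. *)

Definition the {M : ZF_model} (P : M -> Prop) : M :=
  epsilon (ZF_model_inhabited M) (unique P).

(** The class abstract {x | P x}; a junk value if that class is not a set. *)
Definition setof {M : ZF_model} (P : M -> Prop) : M :=
  the (fun s => forall x, x ∈ s <-> P x).

Definition sub {M : ZF_model} (a b : M) : Prop := forall x, x ∈ a -> x ∈ b.

Definition empty {M : ZF_model} : M := setof (fun _ => False).
Definition upair {M : ZF_model} (a b : M) : M := setof (fun x => x = a \/ x = b).
Definition opair {M : ZF_model} (a b : M) : M := upair (upair a a) (upair a b).
Definition pr1 {M : ZF_model} (p : M) : M := the (fun a => exists b, p = opair a b).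
Definition pr2 {M : ZF_model} (p : M) : M := the (fun b => exists a, p = opair a b).
Definition cprod {M : ZF_model} (A B : M) : M :=
  setof (fun p => exists a b, a ∈ A /\ b ∈ B /\ p = opair a b).

Definition is_fun {M : ZF_model} (f A B : M) : Prop :=
  sub f (cprod A B) /\
  forall x, x ∈ A -> exists! y, opair x y ∈ f.
Definition app {M : ZF_model} (f x : M) : M := the (fun y => opair x y ∈ f).
Definition app2 {M : ZF_model} (f x y : M) : M := app f (opair x y).

Definition lam {M : ZF_model} (A : M) (F : M -> M) : M :=
  setof (fun p => exists x, x ∈ A /\ p = opair x (F x)).
Definition lam2 {M : ZF_model} (A : M) (F : M -> M -> M) : M :=
  setof (fun p => exists x y, x ∈ A /\ y ∈ A /\ p = opair (opair x y) (F x y)).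

Definition is_bij {M : ZF_model} (f A B : M) : Prop :=
  is_fun f A B /\ forall y, y ∈ B -> exists! x, x ∈ A /\ app f x = y.

Definition succ {M : ZF_model} (n : M) : M := setof (fun x => x ∈ n \/ x = n).
Definition omega {M : ZF_model} : M :=
  setof (fun n => forall w : M,
    empty ∈ w -> (forall x, x ∈ w -> succ x ∈ w) -> n ∈ w).
Definition nat_add {M : ZF_model} : M :=
  the (fun p => is_fun p (cprod omega omega) omega /\
    forall m, m ∈ omega ->
      app2 p m empty = m /\
      forall n, n ∈ omega -> app2 p m (succ n) = succ (app2 p m n)).

Definition finite {M : ZF_model} (A : M) : Prop :=
  exists n e, n ∈ omega /\ is_bij e n A.

Definition is_family {M : ZF_model} (A I : M) : Prop := exists B, is_fun A I B.
Definition family_union {M : ZF_model} (A I : M) : M :=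
  setof (fun x => exists i, i ∈ I /\ x ∈ app A i).

Record ring (M : ZF_model) : Type := Ring {
  car : M;
  addf : M;
  mulf : M;
  zero : M;
  one : M
}.

Definition radd {M : ZF_model} (R : ring M) (x y : M) : M := app2 (addf R) x y.
Definition rmul {M : ZF_model} (R : ring M) (x y : M) : M := app2 (mulf R) x y.

Record is_comm_ring {M : ZF_model} (R : ring M) : Prop := {
  cr_addf : is_fun (addf R) (cprod (car R) (car R)) (car R);
  cr_mulf : is_fun (mulf R) (cprod (car R) (car R)) (car R);
  cr_zero : zero R ∈ car R;
  cr_one : one R ∈ car R;
  cr_addA : forall x y z, x ∈ car R -> y ∈ car R -> z ∈ car R ->
    radd R x (radd R y z) = radd R (radd R x y) z;
  cr_addC : forall x y, x ∈ car R -> y ∈ car R -> radd R x y = radd R y x;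
  cr_add0 : forall x, x ∈ car R -> radd R (zero R) x = x;
  cr_opp : forall x, x ∈ car R -> exists y, y ∈ car R /\ radd R x y = zero R;
  cr_mulA : forall x y z, x ∈ car R -> y ∈ car R -> z ∈ car R ->
    rmul R x (rmul R y z) = rmul R (rmul R x y) z;
  cr_mulC : forall x y, x ∈ car R -> y ∈ car R -> rmul R x y = rmul R y x;
  cr_mul1 : forall x, x ∈ car R -> rmul R (one R) x = x;
  cr_distr : forall x y z, x ∈ car R -> y ∈ car R -> z ∈ car R ->
    rmul R x (radd R y z) = radd R (rmul R x y) (rmul R x z)
}.

Record is_domain {M : ZF_model} (R : ring M) : Prop := {
  dom_comm_ring : is_comm_ring R;
  dom_nontrivial : one R <> zero R;
  dom_no_zero_div : forall x y, x ∈ car R -> y ∈ car R ->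
    rmul R x y = zero R -> x = zero R \/ y = zero R
}.

Record is_mult_subset {M : ZF_model} (R : ring M) (S : M) : Prop := {
  ms_sub : sub S (car R);
  ms_one : one R ∈ S;
  ms_mul : forall x y, x ∈ S -> y ∈ S -> rmul R x y ∈ S
}.

Record is_ideal {M : ZF_model} (R : ring M) (J : M) : Prop := {
  id_sub : sub J (car R);
  id_zero : zero R ∈ J;
  id_add : forall x y, x ∈ J -> y ∈ J -> radd R x y ∈ J;
  id_mul : forall a x, a ∈ car R -> x ∈ J -> rmul R a x ∈ J
}.

Record is_maximal_ideal {M : ZF_model} (R : ring M) (J : M) : Prop := {
  max_ideal : is_ideal R J;
  max_proper : J <> car R;
  max_max : forall K, is_ideal R K -> sub J K -> K = J \/ K = car R
}.

(** Here [K] is a finite set, [e] enumerates it and [t] lists the partial sums;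
    in a commutative ring the value does not depend on [e]. *)
Definition fsum {M : ZF_model} (R : ring M) (K : M) (F : M -> M) : M :=
  the (fun v => exists n e t,
    n ∈ omega /\ is_bij e n K /\
    is_fun t (succ n) (car R) /\
    app t empty = zero R /\
    (forall k, k ∈ n -> app t (succ k) = radd R (app t k) (F (app e k))) /\
    v = app t n).

(** Monomials are finitely supported exponent functions X → ω, and polynomials
    are finitely supported functions from monomials to R. *)

Definition monomials {M : ZF_model} (X : M) : M :=
  setof (fun m => is_fun m X omega /\
                  finite (setof (fun x => x ∈ X /\ app m x <> empty))).
Definition mono_one {M : ZF_model} (X : M) : M := lam X (fun _ => empty).
Definition mono_mul {M : ZF_model} (X m n : M) : M :=
  lam X (fun x => app2 nat_add (app m x) (app n x)).

Definition supp {M : ZF_model} (R : ring M) (X f : M) : M :=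
  setof (fun m => m ∈ monomials X /\ app f m <> zero R).
Definition polys {M : ZF_model} (R : ring M) (X : M) : M :=
  setof (fun f => is_fun f (monomials X) (car R) /\ finite (supp R X f)).

Definition poly_const {M : ZF_model} (R : ring M) (X c : M) : M :=
  lam (monomials X) (fun m =>
    the (fun v => (m = mono_one X /\ v = c) \/ (m <> mono_one X /\ v = zero R))).
Definition poly_add {M : ZF_model} (R : ring M) (X f g : M) : M :=
  lam (monomials X) (fun m => radd R (app f m) (app g m)).
Definition poly_mul {M : ZF_model} (R : ring M) (X f g : M) : M :=
  lam (monomials X) (fun m =>
    fsum R
      (setof (fun p => exists a b, a ∈ supp R X f /\ b ∈ supp R X g /\
                                   mono_mul X a b = m /\ p = opair a b))
      (fun p => rmul R (app f (pr1 p)) (app g (pr2 p)))).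

Definition poly_ring {M : ZF_model} (R : ring M) (X : M) : ring M := {|
  car := polys R X;
  addf := lam2 (polys R X) (poly_add R X);
  mulf := lam2 (polys R X) (poly_mul R X);
  zero := poly_const R X (zero R);
  one := poly_const R X (one R)
|}.

(** The fraction a/s is the class of the pairs (b, t) for which some u ∈ S
    satisfies u(at) = u(bs). *)
Definition frac {M : ZF_model} (A : ring M) (S a s : M) : M :=
  setof (fun p => exists b t u, b ∈ car A /\ t ∈ S /\ u ∈ S /\ p = opair b t /\
    rmul A u (rmul A a t) = rmul A u (rmul A b s)).

Definition fracs {M : ZF_model} (A : ring M) (S : M) : M :=
  setof (fun c => exists a s, a ∈ car A /\ s ∈ S /\ c = frac A S a s).

Definition localization {M : ZF_model} (A : ring M) (S : M) : ring M := {|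
  car := fracs A S;
  addf := setof (fun p => exists a s b t,
    a ∈ car A /\ s ∈ S /\ b ∈ car A /\ t ∈ S /\
    p = opair (opair (frac A S a s) (frac A S b t))
              (frac A S (radd A (rmul A a t) (rmul A b s)) (rmul A s t)));
  mulf := setof (fun p => exists a s b t,
    a ∈ car A /\ s ∈ S /\ b ∈ car A /\ t ∈ S /\
    p = opair (opair (frac A S a s) (frac A S b t))
              (frac A S (rmul A a b) (rmul A s t)));
  zero := frac A S (zero A) (one A);
  one := frac A S (one A) (one A)
|}.

(* Main.v *)
(** Let X consist of the pairs (i, a) with a ∈ A_i and of one extra variable w.
    For a partial choice function T, viewed as a set of variables, let (T) be the
    ideal of R[X] generated by T: a polynomial lies in (T) if and only if each of
    its monomials involves a variable of T.  Since R is a domain, (T) is prime, so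
    the complement S of the union of all the (T) is multiplicative.  A maximal
    ideal of the localization at S contracts to an ideal J that is maximal among
    those contained in the union of the (T), and J ∩ X is the graph of a choice
    function:
    - if (i, a) and (i, b) are in J, their sum is in some (T), so a = b;
    - f, g ∈ J can be combined into h = f + w^N g ∈ J, and h ∈ (T) forces
      f, g ∈ (T) if N is large.  If no (i, a) is in J, each a yields f_a ∈ J lying
      in no (T) with (i, a) ∈ T.  Fix one a and combine f_a with the f_b for the
      finitely many (i, b) occurring in f_a.  The result lies in some (T); the
      element of T above i does not occur in f_a, so replacing it by (i, a)
      keeps f_a in (T), a contradiction.

    In a model of ZF, sets are formed and inductions performed for definable
    predicates only; definability is preserved by all operations used. *)

From Stdlib Require Import PeanoNat Classical ClassicalEpsilon FunctionalExtensionality.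
From Stdlib Require Import PropExtensionality Ring.
Require Import Defs.

Set Implicit Arguments.
Unset Strict Implicit.

(** * Definability *)

(** Without choice X need not carry a linear order, so no monomial order yields leading terms for
    the primality of (T). Instead, leading exponents are taken one variable at a time within the
    finite set of variables that occur. The variable w is needed because each (i, a) belongs to some
    T, for instance the singleton {(i, a)}; every T consists of pairs, so powers of w separate
    monomials without entering any (T). Maximality is used in one form only: if x is not in J, then
    some f + g x with f in J lies in S. The finitely many f_b are never selected simultaneously: an
    induction over the finite set proves just that a suitable combination exists. As ω of the model
    may be non-standard, no list or number of the metatheory can stand for its finite sets; finite
    sums, the laws of R[X] and all inductions are therefore developed inside the model. [Dprop] and
    [Dterm] say that a predicate or an operation comes from some formula with parameters; closure
    lemmas and a tactic then spare writing formulas out. *)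

Fixpoint ren (r : nat -> nat) (p : form) : form :=
  match p with
  | FMem i j => FMem (r i) (r j)
  | FEq i j => FEq (r i) (r j)
  | FBot => FBot
  | FAnd p q => FAnd (ren r p) (ren r q)
  | FOr p q => FOr (ren r p) (ren r q)
  | FImp p q => FImp (ren r p) (ren r q)
  | FAll p => FAll (ren (scons 0 (fun n => S (r n))) p)
  | FEx p => FEx (ren (scons 0 (fun n => S (r n))) p)
  end.

Lemma sat_ren V (E : V -> V -> Prop) p : forall r e,
  sat E e (ren r p) <-> sat E (fun n => e (r n)) p.
Proof.
  assert (lift : forall r e (x : V),
    (fun n => scons x e (scons 0 (fun n => S (r n)) n)) = scons x (fun n => e (r n))).
  { intros; apply functional_extensionality; intros [|n]; reflexivity. }
  induction p; intros r e; simpl; try tauto; try (rewrite IHp1, IHp2; tauto).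
  - split; intros H x; specialize (H x).
    + apply IHp in H. rewrite lift in H. exact H.
    + apply IHp. rewrite lift. exact H.
  - split; intros [x H]; exists x.
    + apply IHp in H. rewrite lift in H. exact H.
    + apply IHp. rewrite lift. exact H.
Qed.

Section Definability.
Context {M : ZF_model}.
Notation env := (nat -> M).

(** Even indices serve as variables and odd ones as parameters: both supplies are unlimited, and
    parameters can be added without moving a variable. *)
Definition slot (n : nat) : nat + nat :=
  if Nat.even n then inl (Nat.div2 n) else inr (Nat.div2 n).
Definition slot_inv (s : nat + nat) : nat :=
  match s with inl k => 2 * k | inr k => S (2 * k) end.

Lemma slot_invK s : slot (slot_inv s) = s.
Proof.
  unfold slot; destruct s as [k|k]; unfold slot_inv.
  - rewrite Nat.even_mul, Nat.div2_double; reflexivity.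
  - rewrite Nat.even_succ, Nat.odd_mul, Nat.div2_succ_double; reflexivity.
Qed.

Definition mix (v e : env) (n : nat) : M :=
  match slot n with inl k => v k | inr k => e k end.

(** [v] assigns the free variables and [e] the parameters. *)
Definition Dprop (P : env -> Prop) : Prop :=
  exists p e, forall v, sat mem (mix v e) p <-> P v.
(** The language has no function symbols, so a term is represented by its graph, with index 0
    reserved for the value. *)
Definition Dterm (t : env -> M) : Prop :=
  Dprop (fun v => v 0 = t (fun n => v (S n))).

Lemma Dprop_iff P Q : Dprop P -> (forall v, P v <-> Q v) -> Dprop Q.
Proof. intros (p & e & H) PQ; exists p, e; intros v; rewrite H; apply PQ. Qed.

(** Connectives need both formulas in one environment: the two parameter sequences are interleaved
    as [mix e e'], and each formula is renamed to read its own half. *)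
Lemma Dprop_merge P Q : Dprop P -> Dprop Q -> exists p q e, forall v,
  (sat mem (mix v e) p <-> P v) /\ (sat mem (mix v e) q <-> Q v).
Proof.
  intros (p & e & Hp) (q & e' & Hq).
  exists (ren (fun n => match slot n with inl k => slot_inv (inl k)
                                     | inr k => slot_inv (inr (slot_inv (inl k))) end) p).
  exists (ren (fun n => match slot n with inl k => slot_inv (inl k)
                                     | inr k => slot_inv (inr (slot_inv (inr k))) end) q).
  exists (mix e e').
  intros v; rewrite !sat_ren, <- Hp, <- Hq; split.
  - replace (fun n => _) with (mix v e); [tauto|].
    apply functional_extensionality; intros n; unfold mix at 1 2.
    destruct (slot n); rewrite slot_invK; unfold mix; [|rewrite slot_invK]; reflexivity.
  - replace (fun n => _) with (mix v e'); [tauto|].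
    apply functional_extensionality; intros n; unfold mix at 1 2.
    destruct (slot n); rewrite slot_invK; unfold mix; [|rewrite slot_invK]; reflexivity.
Qed.

Lemma Dprop_and P Q : Dprop P -> Dprop Q -> Dprop (fun v => P v /\ Q v).
Proof.
  intros HP HQ; destruct (Dprop_merge HP HQ) as (p & q & e & H).
  exists (FAnd p q), e; intros v; specialize (H v); simpl; tauto.
Qed.

Lemma Dprop_or P Q : Dprop P -> Dprop Q -> Dprop (fun v => P v \/ Q v).
Proof.
  intros HP HQ; destruct (Dprop_merge HP HQ) as (p & q & e & H).
  exists (FOr p q), e; intros v; specialize (H v); simpl; tauto.
Qed.

Lemma Dprop_imp P Q : Dprop P -> Dprop Q -> Dprop (fun v => P v -> Q v).
Proof.
  intros HP HQ; destruct (Dprop_merge HP HQ) as (p & q & e & H).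
  exists (FImp p q), e; intros v; specialize (H v); simpl; tauto.
Qed.

(** By excluded middle a proposition without variables is equivalent to a true or a false formula,
    whatever metatheoretic notions occur in it. *)
Lemma Dprop_const (P : Prop) : Dprop (fun _ => P).
Proof.
  destruct (ZF_model_inhabited M) as [m].
  destruct (classic P); [exists (FImp FBot FBot) | exists FBot]; exists (fun _ => m);
    simpl; tauto.
Qed.

Lemma Dprop_not P : Dprop P -> Dprop (fun v => ~ P v).
Proof. intros; apply Dprop_imp; auto using Dprop_const. Qed.

Lemma Dprop_iffb P Q : Dprop P -> Dprop Q -> Dprop (fun v => P v <-> Q v).
Proof. intros; apply Dprop_and; apply Dprop_imp; auto. Qed.

(** The renaming under a binder: the bound element becomes variable 0, the other variables move up
    by one, and the parameters keep their names. *)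
Lemma mix_scons e v x :
  (fun n => scons x (mix v e)
     (match slot n with inl 0 => 0 | inl (S k) => S (slot_inv (inl k))
                   | inr k => S (slot_inv (inr k)) end)) = mix (scons x v) e.
Proof.
  apply functional_extensionality; intros n; unfold mix at 2.
  destruct (slot n) as [[|k]|k]; [reflexivity| |]; cbn -[slot_inv];
  unfold mix; rewrite slot_invK; reflexivity.
Qed.

Lemma Dprop_all (P : env -> M -> Prop) :
  Dprop (fun v => P (fun n => v (S n)) (v 0)) -> Dprop (fun v => forall x, P v x).
Proof.
  intros (p & e & H).
  (* The renaming is left open and found by unification with [mix_scons]. *)
  eexists (FAll (ren _ p)), e; intros v; simpl; split; intros K x; specialize (K x).
  - rewrite sat_ren, mix_scons in K. apply H in K. exact K.
  - rewrite sat_ren, mix_scons. apply H. exact K.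
Qed.

Lemma Dprop_ex (P : env -> M -> Prop) :
  Dprop (fun v => P (fun n => v (S n)) (v 0)) -> Dprop (fun v => exists x, P v x).
Proof.
  intros (p & e & H).
  eexists (FEx (ren _ p)), e; intros v; simpl; split; intros [x K]; exists x.
  - rewrite sat_ren, mix_scons in K. apply H in K. exact K.
  - rewrite sat_ren, mix_scons. apply H. exact K.
Qed.

Lemma Dprop_ren r P : Dprop P -> Dprop (fun v => P (fun n => v (r n))).
Proof.
  intros (p & e & H).
  exists (ren (fun n => match slot n with inl k => slot_inv (inl (r k))
                                     | inr k => slot_inv (inr k) end) p), e.
  intros v; rewrite sat_ren, <- H.
  replace (fun n => _) with (mix (fun n => v (r n)) e); [tauto|].
  apply functional_extensionality; intros n; unfold mix.
  destruct (slot n); rewrite slot_invK; reflexivity.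
Qed.

Lemma Dterm_ren r t : Dterm t -> Dterm (fun v => t (fun n => v (r n))).
Proof. intros H; exact (Dprop_ren (scons 0 (fun n => S (r n))) H). Qed.

Lemma Dprop_eq0 k : Dprop (fun v => v 0 = v k).
Proof.
  destruct (ZF_model_inhabited M) as [m].
  exists (FEq (slot_inv (inl 0)) (slot_inv (inl k))), (fun _ => m).
  intros v; cbn [sat]; unfold mix; rewrite !slot_invK; tauto.
Qed.

Lemma Dterm_var k : Dterm (fun v => v k).
Proof. exact (Dprop_eq0 (S k)). Qed.

Lemma Dterm_const (c : M) : Dterm (fun _ => c).
Proof.
  exists (FEq (slot_inv (inl 0)) (slot_inv (inr 0))), (fun _ => c).
  intros v; cbn [sat]; unfold mix; rewrite !slot_invK; tauto.
Qed.

(** Only the graph of [t] is available, hence the detour through [exists x, x = t v /\ P v x]. *)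
Lemma Dprop_subst (P : env -> M -> Prop) (t : env -> M) :
  Dterm t -> Dprop (fun v => P (fun n => v (S n)) (v 0)) -> Dprop (fun v => P v (t v)).
Proof.
  intros Ht HP.
  apply Dprop_iff with (fun v => exists x, x = t v /\ P v x).
  - apply Dprop_ex, Dprop_and; assumption.
  - intros v; split; [intros (x & -> & H); exact H | eauto].
Qed.

Lemma Dprop_eq t u : Dterm t -> Dterm u -> Dprop (fun v => t v = u v).
Proof.
  intros Ht Hu.
  apply (@Dprop_subst (fun v x => x = u v)); [exact Ht | exact Hu].
Qed.

Lemma Dprop_mem t u : Dterm t -> Dterm u -> Dprop (fun v => t v ∈ u v).
Proof.
  intros Ht Hu.
  apply (@Dprop_subst (fun v x => x ∈ u v)); [exact Ht|].
  apply (@Dprop_subst (fun v y => v 0 ∈ y)); [exact (Dterm_ren S Hu)|].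
  destruct (ZF_model_inhabited M) as [m].
  exists (FMem (slot_inv (inl 1)) (slot_inv (inl 0))), (fun _ => m).
  intros v; cbn [sat]; unfold mix; rewrite !slot_invK; tauto.
Qed.

Lemma the_eq (P : M -> Prop) y : P y -> (forall z, P z -> z = y) -> the P = y.
Proof.
  intros Py U. unfold the.
  assert (E : unique P (epsilon (ZF_model_inhabited M) (unique P))).
  { apply epsilon_spec; exists y; split; [exact Py|].
    intros z Pz; symmetry; auto. }
  destruct E as [_ E]; apply E; exact Py.
Qed.

Lemma the_spec (P : M -> Prop) : (exists! y, P y) -> P (the P).
Proof.
  intros (y & Py & U); rewrite (@the_eq P y Py); [exact Py|].
  intros z Pz; symmetry; auto.
Qed.

Lemma the_ext (P Q : M -> Prop) : (forall x, P x <-> Q x) -> the P = the Q.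
Proof.
  intros H; replace Q with P; [reflexivity|].
  apply functional_extensionality; intros x; apply propositional_extensionality, H.
Qed.

(** By extensionality of predicates the junk value of [the] does not depend on
    the predicate, so that [the] preserves definability without any guard. *)
Lemma the_junk (P : M -> Prop) :
  ~ (exists! y, P y) -> the P = epsilon (ZF_model_inhabited M) (fun _ => False).
Proof.
  intros H; unfold the; f_equal.
  apply functional_extensionality; intros x; apply propositional_extensionality.
  split; [intros U; apply H; exists x; exact U | tauto].
Qed.

(** The graph has two cases: the value is the unique witness, or there is no unique witness and the
    value is the common junk element, which becomes a parameter. *)
Lemma Dterm_the (P : env -> M -> Prop) :
  Dprop (fun v => P (fun n => v (S n)) (v 0)) -> Dterm (fun v => the (fun y => P v y)).
Proof.
  intros HP. unfold Dterm.
  assert (HU : Dprop (fun v => unique (P (fun n => v (S n))) (v 0))).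
  { apply Dprop_and; [exact HP|].
    apply (@Dprop_all (fun v x => P (fun n => v (S n)) x -> v 0 = x)).
    apply Dprop_imp; [|apply Dprop_eq; apply Dterm_var].
    exact (Dprop_ren (scons 0 (fun n => S (S n))) HP). }
  apply Dprop_iff with (fun v =>
    unique (P (fun n => v (S n))) (v 0) \/
    (~ (exists x, unique (P (fun n => v (S n))) x) /\
     v 0 = epsilon (ZF_model_inhabited M) (fun _ => False))).
  - apply Dprop_or; [exact HU|]. apply Dprop_and.
    + apply Dprop_not. apply (@Dprop_ex (fun v x => unique (P (fun n => v (S n))) x)).
      exact (Dprop_ren (scons 0 (fun n => S (S n))) HU).
    + apply Dprop_eq; [apply Dterm_var | apply Dterm_const].
  - intros v; set (Q := P (fun n => v (S n))). change (fun y => P _ y) with Q.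
    destruct (classic (exists! y, Q y)) as [E|E].
    + pose proof (the_spec E) as S1. destruct E as (y & Qy & U). split.
      * intros [[Qv U']|[N _]]; [apply U'; exact S1 | exfalso; apply N; exists y; split; auto].
      * intros ->; left; split; [exact S1|]. intros z Qz. rewrite <- (U _ S1). auto.
    + rewrite (@the_junk Q E). split; [intros [N|[_ N]]; [exfalso; eauto|exact N]|auto].
Qed.

Lemma Dterm_setof (P : env -> M -> Prop) :
  Dprop (fun v => P (fun n => v (S n)) (v 0)) -> Dterm (fun v => setof (fun y => P v y)).
Proof.
  intros HP. unfold setof.
  apply (@Dterm_the (fun v s => forall x, x ∈ s <-> P v x)).
  apply (@Dprop_all (fun v x => x ∈ v 0 <-> P (fun n => v (S n)) x)).
  apply Dprop_iffb; [apply Dprop_mem; apply Dterm_var|].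
  exact (Dprop_ren (scons 0 (fun n => S (S n))) HP).
Qed.

(** Definability of an operation is proved once, on variables; the congruence lemmas transfer it to
    arbitrary definable arguments. *)
Lemma Dterm_congr1 (F : M -> M) :
  Dterm (fun v => F (v 0)) -> forall t, Dterm t -> Dterm (fun v => F (t v)).
Proof.
  intros HF t Ht. unfold Dterm.
  apply (@Dprop_subst (fun v x => v 0 = F x)).
  - exact (Dterm_ren S Ht).
  - exact (Dprop_ren (scons 1 (scons 0 (fun n => n))) HF).
Qed.

Lemma Dterm_congr2 (F : M -> M -> M) : Dterm (fun v => F (v 0) (v 1)) ->
  forall t u, Dterm t -> Dterm u -> Dterm (fun v => F (t v) (u v)).
Proof.
  intros HF t u Ht Hu. unfold Dterm.
  apply (@Dprop_subst (fun v x => v 0 = F x (u (fun n => v (S n))))).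
  - exact (Dterm_ren S Ht).
  - apply (@Dprop_subst (fun v y => v 1 = F (v 0) y)).
    + exact (Dterm_ren (fun n => S (S n)) Hu).
    + exact (Dprop_ren (scons 2 (scons 1 (scons 0 (fun n => n)))) HF).
Qed.

Lemma Dprop_congr1 (P : M -> Prop) :
  Dprop (fun v => P (v 0)) -> forall t, Dterm t -> Dprop (fun v => P (t v)).
Proof.
  intros HP t Ht. apply (@Dprop_subst (fun v x => P x)); [exact Ht|].
  exact (Dprop_ren (fun n => n) HP).
Qed.

Lemma Dprop_congr2 (P : M -> M -> Prop) : Dprop (fun v => P (v 0) (v 1)) ->
  forall t u, Dterm t -> Dterm u -> Dprop (fun v => P (t v) (u v)).
Proof.
  intros HP t u Ht Hu. apply (@Dprop_subst (fun v x => P x (u v))); [exact Ht|].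
  apply (@Dprop_subst (fun v y => P (v 0) y)).
  - exact (Dterm_ren S Hu).
  - exact (Dprop_ren (scons 1 (scons 0 (fun n => n))) HP).
Qed.

Lemma Dprop_congr3 (P : M -> M -> M -> Prop) : Dprop (fun v => P (v 0) (v 1) (v 2)) ->
  forall t u w, Dterm t -> Dterm u -> Dterm w -> Dprop (fun v => P (t v) (u v) (w v)).
Proof.
  intros HP t u w Ht Hu Hw.
  apply (@Dprop_subst (fun v x => P x (u v) (w v))); [exact Ht|].
  apply (@Dprop_subst (fun v y => P (v 0) y (w (fun n => v (S n))))).
  - exact (Dterm_ren S Hu).
  - apply (@Dprop_subst (fun v y => P (v 1) (v 0) y)).
    + exact (Dterm_ren (fun n => S (S n)) Hw).
    + exact (Dprop_ren (scons 2 (scons 1 (scons 0 (fun n => n)))) HP).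
Qed.
End Definability.


(** Redefined below each time further operations are proved definable. *)
Ltac def_hook := fail.

(** Propositions independent of the environment are closed first. The [is_var] cases treat an
    abstract operation or predicate whose definability is a hypothesis. *)
Ltac def_step :=
  match goal with
  | |- Dprop (fun _ => ?P) => apply Dprop_const
  | |- Dprop (fun v => _ /\ _) => apply Dprop_and
  | |- Dprop (fun v => _ \/ _) => apply Dprop_or
  | |- Dprop (fun v => ~ _) => apply Dprop_not
  | |- Dprop (fun v => _ <-> _) => apply Dprop_iffb
  | |- Dprop (fun v => _ = _) => apply Dprop_eq
  | |- Dprop (fun v => _ ∈ _) => apply Dprop_mem
  | |- Dprop (fun v => ex _) => apply Dprop_ex; cbv beta
  | |- Dprop (fun v => (@?P v -> @?Q v)) => apply Dprop_imp
  | |- Dprop (fun v => forall x, _) => apply Dprop_all; cbv beta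
  | |- Dprop (fun v => unique _ _) => unfold unique
  | |- Dterm (fun _ => ?c) => apply Dterm_const
  | |- Dterm (fun v => v _) => apply Dterm_var
  | |- Dterm (fun v => the _) => apply Dterm_the; cbv beta
  | |- Dterm (fun v => setof _) => apply Dterm_setof; cbv beta
  | |- Dterm (fun v => ?F _) => is_var F;
      match goal with H : Dterm _ |- _ => apply (@Dterm_congr1 _ F H) end
  | |- Dterm (fun v => ?F _ _) => is_var F;
      match goal with H : Dterm _ |- _ => apply (@Dterm_congr2 _ F H) end
  | |- Dprop (fun v => ?P _) => is_var P;
      match goal with H : Dprop _ |- _ => apply (@Dprop_congr1 _ P H) end
  | |- Dprop (fun v => ?P _ _) => is_var P;
      match goal with H : Dprop _ |- _ => apply (@Dprop_congr2 _ P H) end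
  | _ => def_hook
  end.

Ltac definable := cbv beta; repeat def_step.

(** * Definability of the set-theoretic and algebraic operations *)

Lemma D_sub (M : ZF_model) : Dprop (fun v => @sub M (v 0) (v 1)).
Proof. unfold sub; definable. Qed.

Lemma D_upair (M : ZF_model) : Dterm (fun v => @upair M (v 0) (v 1)).
Proof. unfold upair; definable. Qed.

Ltac def_sets1 :=
  match goal with
  | |- Dprop (fun v => sub _ _) => apply (@Dprop_congr2 _ _ (@D_sub _))
  | |- Dterm (fun v => upair _ _) => apply (@Dterm_congr2 _ _ (@D_upair _))
  end.
Ltac def_hook ::= def_sets1.

Lemma D_opair (M : ZF_model) : Dterm (fun v => @opair M (v 0) (v 1)).
Proof. unfold opair; definable. Qed.

Ltac def_sets2 :=
  match goal with
  | |- Dterm (fun v => opair _ _) => apply (@Dterm_congr2 _ _ (@D_opair _))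
  | _ => def_sets1
  end.
Ltac def_hook ::= def_sets2.

Lemma D_pr1 M : Dterm (fun v => @pr1 M (v 0)).
Proof. unfold pr1; definable. Qed.
Lemma D_pr2 M : Dterm (fun v => @pr2 M (v 0)).
Proof. unfold pr2; definable. Qed.
Lemma D_cprod (M : ZF_model) : Dterm (fun v => @cprod M (v 0) (v 1)).
Proof. unfold cprod; definable. Qed.
Lemma D_app (M : ZF_model) : Dterm (fun v => @app M (v 0) (v 1)).
Proof. unfold app; definable. Qed.
Lemma D_succ (M : ZF_model) : Dterm (fun v => @succ M (v 0)).
Proof. unfold succ; definable. Qed.

Lemma Dterm_lam (M : ZF_model) A (F : (nat -> M) -> M -> M) :
  Dterm A -> Dterm (fun v => F (fun n => v (S n)) (v 0)) ->
  Dterm (fun v => lam (A v) (fun x => F v x)).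
Proof.
  intros HA HF. unfold lam; definable.
  - exact (Dterm_ren (fun n => S (S n)) HA).
  - exact (Dterm_ren (scons 0 (fun n => S (S n))) HF).
Qed.

Ltac def_sets3 :=
  match goal with
  | |- Dterm (fun v => pr1 _) => apply (@Dterm_congr1 _ _ (@D_pr1 _))
  | |- Dterm (fun v => pr2 _) => apply (@Dterm_congr1 _ _ (@D_pr2 _))
  | |- Dterm (fun v => cprod _ _) => apply (@Dterm_congr2 _ _ (@D_cprod _))
  | |- Dterm (fun v => app _ _) => apply (@Dterm_congr2 _ _ (@D_app _))
  | |- Dterm (fun v => app2 _ _ _) => unfold app2
  | |- Dterm (fun v => succ _) => apply (@Dterm_congr1 _ _ (@D_succ _))
  | |- Dterm (fun v => lam _ _) => apply Dterm_lam; cbv beta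
  | |- Dterm (fun v => radd _ _ _) => unfold radd
  | |- Dterm (fun v => rmul _ _ _) => unfold rmul
  | _ => def_sets2
  end.
Ltac def_hook ::= def_sets3.

Lemma D_is_fun (M : ZF_model) : Dprop (fun v => @is_fun M (v 0) (v 1) (v 2)).
Proof. unfold is_fun; definable. Qed.

Ltac def_sets4 :=
  match goal with
  | |- Dprop (fun v => is_fun _ _ _) => apply (@Dprop_congr3 _ _ (@D_is_fun _))
  | _ => def_sets3
  end.
Ltac def_hook ::= def_sets4.

Lemma D_is_bij (M : ZF_model) : Dprop (fun v => @is_bij M (v 0) (v 1) (v 2)).
Proof. unfold is_bij; definable. Qed.

Ltac def_sets5 :=
  match goal with
  | |- Dprop (fun v => is_bij _ _ _) => apply (@Dprop_congr3 _ _ (@D_is_bij _))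
  | _ => def_sets4
  end.
Ltac def_hook ::= def_sets5.

Lemma D_finite (M : ZF_model) : Dprop (fun v => @finite M (v 0)).
Proof. unfold finite; definable. Qed.

Lemma Dterm_fsum (M : ZF_model) (R : ring M) K (F : (nat -> M) -> M -> M) :
  Dterm K -> Dterm (fun v => F (fun n => v (S n)) (v 0)) ->
  Dterm (fun v => fsum R (K v) (fun x => F v x)).
Proof.
  intros HK HF. unfold fsum; definable.
  - exact (Dterm_ren (fun n => S (S (S (S n)))) HK).
  - apply (@Dprop_subst M (fun v x => v 0 = F (fun n => v (S (S (S (S (S (S n)))))))  x)).
    + definable.
    + exact (Dprop_ren (scons 1 (scons 0 (fun n => S (S (S (S (S (S (S n)))))))))  HF).
Qed.

Ltac def_sets6 :=
  match goal with
  | |- Dprop (fun v => finite _) => apply (@Dprop_congr1 _ _ (@D_finite _))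
  | |- Dterm (fun v => fsum _ _ _) => apply Dterm_fsum; cbv beta
  | _ => def_sets5
  end.
Ltac def_hook ::= def_sets6.

Lemma D_mono_mul (M : ZF_model) (X : M) : Dterm (fun v => mono_mul X (v 0) (v 1)).
Proof. unfold mono_mul; definable. Qed.
Lemma D_supp (M : ZF_model) (R : ring M) (X : M) : Dterm (fun v => supp R X (v 0)).
Proof. unfold supp; definable. Qed.
Lemma D_poly_add (M : ZF_model) (R : ring M) (X : M) : Dterm (fun v => poly_add R X (v 0) (v 1)).
Proof. unfold poly_add; definable. Qed.

Ltac def_sets7 :=
  match goal with
  | |- Dterm (fun v => mono_mul ?X _ _) => apply (@Dterm_congr2 _ (mono_mul X) (@D_mono_mul _ X))
  | |- Dterm (fun v => supp ?R ?X _) => apply (@Dterm_congr1 _ (supp R X) (@D_supp _ R X))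
  | |- Dterm (fun v => poly_add ?R ?X _ _) => apply (@Dterm_congr2 _ (poly_add R X) (@D_poly_add _ R X))
  | _ => def_sets6
  end.
Ltac def_hook ::= def_sets7.

Lemma D_poly_mul (M : ZF_model) (R : ring M) (X : M) : Dterm (fun v => poly_mul R X (v 0) (v 1)).
Proof. unfold poly_mul; definable. Qed.

Ltac def_sets :=
  match goal with
  | |- Dterm (fun v => poly_mul ?R ?X _ _) => apply (@Dterm_congr2 _ (poly_mul R X) (@D_poly_mul _ R X))
  | _ => def_sets7
  end.
Ltac def_hook ::= def_sets.

(** * Sets and functions *)

Section Sets.
Context {M : ZF_model}.
Implicit Types a b c x y z A B C K : M.

Lemma set_ext a b : (forall x, x ∈ a <-> x ∈ b) -> a = b.
Proof. apply (zf_ext (mem_is_ZF M)). Qed.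

Lemma in_setof (P : M -> Prop) :
  (exists s, forall x, x ∈ s <-> P x) -> forall x, x ∈ setof P <-> P x.
Proof.
  intros [s Hs]. unfold setof. apply (@the_spec _ (fun s => forall x, x ∈ s <-> P x)).
  exists s; split; [exact Hs|]. intros t Ht; apply set_ext; intros x; rewrite Hs, Ht; tauto.
Qed.

(** The way in which class abstracts become sets: the predicate has to be definable and bounded by
    some set [a], of which the result is independent. *)
Lemma in_sep (P : M -> Prop) a :
  Dprop (fun v => P (v 0)) -> (forall x, P x -> x ∈ a) ->
  forall x, x ∈ setof P <-> P x.
Proof.
  intros (p & e & H) Pa. apply in_setof.
  (* [P] reads variable 0 only, so all variable slots may be sent to the separated element, which
     has index 0; the parameters follow it. *)
  destruct (zf_sep (mem_is_ZF M)
    (ren (fun n => match slot n with inl _ => 0 | inr k => S k end) p) e a) as [c Hc].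
  exists c; intros x; rewrite Hc, sat_ren.
  replace (fun n => _) with (mix (fun _ => x) e).
  - rewrite H. split; [tauto | auto].
  - apply functional_extensionality; intros n; unfold mix; destruct (slot n); reflexivity.
Qed.

Lemma not_in_self x : ~ x ∈ x.
Proof.
  intros H.
  destruct (zf_pair (mem_is_ZF M) x x) as [c Hc].
  destruct (zf_found (mem_is_ZF M) c) as (y & yc & Hy).
  - exists x; apply Hc; auto.
  - assert (y = x) as -> by (apply Hc in yc; tauto). exact (Hy x H yc).
Qed.

Lemma in_empty x : ~ x ∈ empty.
Proof.
  intros H. destruct (zf_inf (mem_is_ZF M)) as (_ & (z & _ & Hz) & _).
  unfold empty in H. apply (@in_setof (fun _ => False)) in H; [exact H|]. exists z; intros y; split; [apply Hz | tauto].
Qed.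

Lemma eq_empty a : (forall x, ~ x ∈ a) -> a = empty.
Proof. intros H; apply set_ext; intros x; split; [intros K; destruct (H x K) | intros K; destruct (in_empty K)]. Qed.

Lemma in_upair a b x : x ∈ upair a b <-> x = a \/ x = b.
Proof. apply (@in_setof (fun x => x = a \/ x = b)), (zf_pair (mem_is_ZF M)). Qed.

Lemma upair_inj a b c d : upair a b = upair c d -> (a = c /\ b = d) \/ (a = d /\ b = c).
Proof.
  intros E.
  assert (H : forall x, (x = a \/ x = b) <-> (x = c \/ x = d)).
  { intros x; rewrite <- !in_upair, E; tauto. }
  pose proof (proj1 (H a) (or_introl eq_refl)). pose proof (proj1 (H b) (or_intror eq_refl)).
  pose proof (proj2 (H c) (or_introl eq_refl)). pose proof (proj2 (H d) (or_intror eq_refl)).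
  intuition congruence.
Qed.

Lemma opair_inj a b c d : opair a b = opair c d -> a = c /\ b = d.
Proof.
  intros E. apply upair_inj in E.
  destruct E as [[E1 E2]|[E1 E2]]; apply upair_inj in E1; apply upair_inj in E2;
    intuition congruence.
Qed.

Lemma pr1_opair a b : pr1 (opair a b) = a.
Proof.
  apply the_eq; [exists b; reflexivity|]. intros z [c E]; apply opair_inj in E; symmetry; tauto.
Qed.

Lemma pr2_opair a b : pr2 (opair a b) = b.
Proof.
  apply the_eq; [exists a; reflexivity|]. intros z [c E]; apply opair_inj in E; symmetry; tauto.
Qed.

Definition pow a : M := setof (fun x => sub x a).
Definition cup a b : M := setof (fun x => x ∈ a \/ x ∈ b).
Definition insert a x : M := setof (fun y => y ∈ a \/ y = x).
Definition remove a x : M := setof (fun y => y ∈ a /\ y <> x).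

Lemma in_pow a x : x ∈ pow a <-> sub x a.
Proof. apply (@in_setof (fun x => sub x a)), (zf_power (mem_is_ZF M)). Qed.

Lemma in_cup a b x : x ∈ cup a b <-> x ∈ a \/ x ∈ b.
Proof.
  destruct (zf_union (mem_is_ZF M) (upair a b)) as [c Hc].
  apply (@in_setof (fun x => x ∈ a \/ x ∈ b)); exists c; intros y; rewrite Hc; split.
  - intros (z & Hz & yz); apply in_upair in Hz; destruct Hz; subst; auto.
  - intros [H|H]; [exists a | exists b]; rewrite in_upair; auto.
Qed.

Lemma in_insert a x y : y ∈ insert a x <-> y ∈ a \/ y = x.
Proof.
  unfold insert. apply in_sep with (a := cup a (upair x x)); [definable|].
  intros z; rewrite in_cup, in_upair; tauto.
Qed.

Lemma in_succ a y : y ∈ succ a <-> y ∈ a \/ y = a.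
Proof. exact (in_insert a a y). Qed.

Lemma in_remove a x y : y ∈ remove a x <-> y ∈ a /\ y <> x.
Proof. unfold remove. apply in_sep with (a := a); [definable | tauto]. Qed.

Lemma insert_remove a x : x ∈ a -> insert (remove a x) x = a.
Proof.
  intros H; apply set_ext; intros y; rewrite in_insert, in_remove.
  split; [intros [[]| ->]; auto | destruct (classic (y = x)); auto].
Qed.

Lemma remove_insert a x : ~ x ∈ a -> remove (insert a x) x = a.
Proof.
  intros H; apply set_ext; intros y; rewrite in_remove, in_insert.
  split; [tauto | intros K; split; [auto | intros ->; auto]].
Qed.

Lemma opair_in_pow a b A B : a ∈ A -> b ∈ B -> opair a b ∈ pow (pow (cup A B)).
Proof.
  intros Ha Hb. apply in_pow; intros u Hu; apply in_pow; intros x Hx. apply in_cup.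
  apply in_upair in Hu; destruct Hu; subst; apply in_upair in Hx; destruct Hx; subst; auto.
Qed.

Lemma in_cprod A B p : p ∈ cprod A B <-> exists a b, a ∈ A /\ b ∈ B /\ p = opair a b.
Proof.
  unfold cprod; apply in_sep with (a := pow (pow (cup A B))); [definable|].
  intros x (a & b & Ha & Hb & ->); apply opair_in_pow; assumption.
Qed.

Lemma opair_in_cprod A B a b : opair a b ∈ cprod A B <-> a ∈ A /\ b ∈ B.
Proof.
  rewrite in_cprod; split.
  - intros (c & d & Hc & Hd & E); apply opair_inj in E; destruct E; subst; auto.
  - intros []; exists a, b; auto.
Qed.

Section Functions.
Context {f A B : M} (Hf : is_fun f A B).

Lemma fun_graph x : x ∈ A -> opair x (app f x) ∈ f.
Proof. intros Hx; exact (@the_spec _ (fun y => opair x y ∈ f) (proj2 Hf x Hx)). Qed.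

Lemma fun_dom x y : opair x y ∈ f -> x ∈ A /\ y ∈ B.
Proof. intros H; apply (proj1 Hf) in H; apply opair_in_cprod in H; exact H. Qed.

Lemma fun_app x : x ∈ A -> app f x ∈ B.
Proof. intros Hx; apply fun_graph in Hx; apply fun_dom in Hx; tauto. Qed.

Lemma fun_eq x y : opair x y ∈ f -> app f x = y.
Proof.
  intros H. pose proof (fun_dom H) as [Hx _].
  destruct (proj2 Hf x Hx) as (z & Hz & U). rewrite <- (U y H). symmetry; apply U, fun_graph, Hx.
Qed.

Lemma fun_in p : p ∈ f -> exists x, x ∈ A /\ p = opair x (app f x).
Proof.
  intros H. pose proof (proj1 Hf p H) as K; apply in_cprod in K.
  destruct K as (x & y & Hx & Hy & ->); exists x; split; [exact Hx|]. rewrite (fun_eq H); reflexivity.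
Qed.

Lemma fun_in_pow : f ∈ pow (cprod A B).
Proof. apply in_pow, Hf. Qed.
End Functions.

Lemma fun_ext f g A B B' : is_fun f A B -> is_fun g A B' ->
  (forall x, x ∈ A -> app f x = app g x) -> f = g.
Proof.
  intros Hf Hg H; apply set_ext; intros p; split; intros Hp.
  - destruct (fun_in Hf Hp) as (x & Hx & ->). rewrite (H x Hx); apply (fun_graph Hg), Hx.
  - destruct (fun_in Hg Hp) as (x & Hx & ->). rewrite <- (H x Hx); apply (fun_graph Hf), Hx.
Qed.

Section Lam.
Context {F : M -> M} (DF : Dterm (fun v => F (v 0))) {A B : M}
  (HF : forall x, x ∈ A -> F x ∈ B).

Lemma in_lam p : p ∈ lam A F <-> exists x, x ∈ A /\ p = opair x (F x).
Proof.
  unfold lam; apply in_sep with (a := cprod A B); [definable|].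
  intros q (x & Hx & ->); apply opair_in_cprod; auto.
Qed.

Lemma lam_fun : is_fun (lam A F) A B.
Proof.
  split.
  - intros p Hp; apply in_lam in Hp; destruct Hp as (x & Hx & ->). apply opair_in_cprod; auto.
  - intros x Hx; exists (F x); split.
    + apply in_lam; eauto.
    + intros y Hy; apply in_lam in Hy. destruct Hy as (x' & _ & E); apply opair_inj in E.
      destruct E; subst; reflexivity.
Qed.

Lemma app_lam x : x ∈ A -> app (lam A F) x = F x.
Proof. intros Hx; apply (fun_eq lam_fun), in_lam; eauto. Qed.
End Lam.

Section Lam2.
Context {F : M -> M -> M} (DF : Dterm (fun v => F (v 0) (v 1))) {A : M}
  (HF : forall x y, x ∈ A -> y ∈ A -> F x y ∈ A).

Lemma in_lam2 p : p ∈ lam2 A F <->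
  exists x y, x ∈ A /\ y ∈ A /\ p = opair (opair x y) (F x y).
Proof.
  unfold lam2; apply in_sep with (a := cprod (cprod A A) A); [definable|].
  intros q (x & y & Hx & Hy & ->); rewrite !opair_in_cprod; auto.
Qed.

Lemma lam2_fun : is_fun (lam2 A F) (cprod A A) A.
Proof.
  split.
  - intros p Hp; apply in_lam2 in Hp; destruct Hp as (x & y & Hx & Hy & ->).
    rewrite !opair_in_cprod; auto.
  - intros q Hq; apply in_cprod in Hq; destruct Hq as (x & y & Hx & Hy & ->).
    exists (F x y); split.
    + apply in_lam2; exists x, y; auto.
    + intros z Hz; apply in_lam2 in Hz. destruct Hz as (x' & y' & _ & _ & E).
      apply opair_inj in E; destruct E as [E ->]; apply opair_inj in E; destruct E; subst; reflexivity.
Qed.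

Lemma app2_lam2 x y : x ∈ A -> y ∈ A -> app2 (lam2 A F) x y = F x y.
Proof. intros Hx Hy; apply (fun_eq lam2_fun), in_lam2; exists x, y; auto. Qed.
End Lam2.

Lemma fun_insert f A B x y : is_fun f A B -> ~ x ∈ A -> y ∈ B ->
  is_fun (insert f (opair x y)) (insert A x) B /\
  app (insert f (opair x y)) x = y /\
  forall z, z ∈ A -> app (insert f (opair x y)) z = app f z.
Proof.
  intros Hf Nx Hy.
  assert (Hg : is_fun (insert f (opair x y)) (insert A x) B).
  { split.
    - intros p Hp; apply in_insert in Hp; destruct Hp as [Hp| ->].
      + destruct (fun_in Hf Hp) as (z & Hz & ->). rewrite opair_in_cprod, in_insert.
        split; [auto | apply (fun_app Hf Hz)].
      + rewrite opair_in_cprod, in_insert; auto.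
    - intros z Hz. apply in_insert in Hz; destruct Hz as [Hz| ->].
      + exists (app f z); split; [apply in_insert; left; apply (fun_graph Hf Hz)|].
        intros w Hw; apply in_insert in Hw; destruct Hw as [Hw|E]; [apply (fun_eq Hf Hw)|].
        apply opair_inj in E; destruct E; subst; tauto.
      + exists y; split; [apply in_insert; auto|].
        intros w Hw; apply in_insert in Hw; destruct Hw as [Hw|E].
        * apply (fun_dom Hf) in Hw; tauto.
        * apply opair_inj in E; destruct E; subst; reflexivity. }
  split; [exact Hg|]. split.
  - apply (fun_eq Hg), in_insert; auto.
  - intros z Hz. apply (fun_eq Hg), in_insert; left; apply (fun_graph Hf Hz).
Qed.

Lemma fun_restrict f A B C D : is_fun f A B -> sub C A -> (forall x, x ∈ C -> app f x ∈ D) ->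
  is_fun (lam C (fun x => app f x)) C D /\
  forall x, x ∈ C -> app (lam C (fun x => app f x)) x = app f x.
Proof.
  intros Hf HC HD. split.
  - apply lam_fun; [definable | exact HD].
  - intros x Hx. refine (@app_lam (fun x => app f x) _ C D HD x Hx); definable.
Qed.
End Sets.

Lemma D_insert (M : ZF_model) : Dterm (fun v => @insert M (v 0) (v 1)).
Proof. unfold insert; definable. Qed.
Lemma D_remove (M : ZF_model) : Dterm (fun v => @remove M (v 0) (v 1)).
Proof. unfold remove; definable. Qed.
Lemma D_cup (M : ZF_model) : Dterm (fun v => @cup M (v 0) (v 1)).
Proof. unfold cup; definable. Qed.

Ltac def_ops :=
  match goal with
  | |- Dterm (fun v => insert _ _) => apply (@Dterm_congr2 _ _ (@D_insert _))
  | |- Dterm (fun v => remove _ _) => apply (@Dterm_congr2 _ _ (@D_remove _))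
  | |- Dterm (fun v => cup _ _) => apply (@Dterm_congr2 _ _ (@D_cup _))
  | _ => def_sets
  end.
Ltac def_hook ::= def_ops.

(** * Natural numbers *)

Section Omega.
Context {M : ZF_model}.
Implicit Types m n k x y A B : M.

Lemma in_omega n : n ∈ omega <-> forall w : M,
  empty ∈ w -> (forall x, x ∈ w -> succ x ∈ w) -> n ∈ w.
Proof.
  destruct (zf_inf (mem_is_ZF M)) as (w & (z & zw & Hz) & Hw).
  unfold omega; apply in_sep with (a := w); [definable|].
  intros x H; apply H.
  - rewrite <- (eq_empty Hz); exact zw.
  - intros y Hy; destruct (Hw y Hy) as (s & sw & Hs).
    replace (succ y) with s; [exact sw|]. apply set_ext; intros u; rewrite in_succ; apply Hs.
Qed.

Lemma omega_0 : @empty M ∈ omega.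
Proof. apply in_omega; auto. Qed.

Lemma omega_S n : n ∈ omega -> succ n ∈ omega.
Proof. rewrite !in_omega; intros H w H0 HS; apply HS, H; assumption. Qed.

(** The minimality of [omega] speaks of sets, so the elements satisfying [P] must form one; for
    undefinable [P] this can fail in a non-standard model. *)
Lemma omega_ind (P : M -> Prop) : Dprop (fun v => P (v 0)) ->
  P empty -> (forall n, n ∈ omega -> P n -> P (succ n)) -> forall n, n ∈ omega -> P n.
Proof.
  intros DP P0 PS.
  assert (H : forall n, n ∈ setof (fun n => n ∈ omega /\ P n) <-> n ∈ omega /\ P n).
  { apply in_sep with (a := omega); [definable | tauto]. }
  intros n Hn; apply H. pose proof (proj1 (in_omega n) Hn) as K; apply K.
  - apply H; split; [apply omega_0 | exact P0].
  - intros x Hx; apply H in Hx; apply H; destruct Hx; split; auto using omega_S.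
Qed.

Lemma succ_neq_0 n : succ n <> empty.
Proof. intros E. apply (@in_empty M n). rewrite <- E; apply in_succ; auto. Qed.

Lemma empty_in_succ n : n ∈ omega -> empty ∈ succ n.
Proof.
  revert n; apply (@omega_ind (fun n => empty ∈ succ n)); [definable| |].
  - apply in_succ; auto.
  - intros n _ H; apply in_succ; auto.
Qed.

Lemma succ_in_succ n k : n ∈ omega -> k ∈ n -> succ k ∈ succ n.
Proof.
  intros Hn; revert n Hn k.
  apply (@omega_ind (fun n => forall k, k ∈ n -> succ k ∈ succ n)); [definable| |].
  - intros k Hk; destruct (in_empty Hk).
  - intros n _ IH k Hk; apply in_succ in Hk; apply in_succ; destruct Hk as [Hk| ->]; auto.
Qed.

Lemma not_in_cycle x y : x ∈ y -> y ∈ x -> False.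
Proof.
  intros H1 H2.
  destruct (zf_found (mem_is_ZF M) (upair x y)) as (z & Hz & K).
  - exists x; apply in_upair; auto.
  - apply in_upair in Hz; destruct Hz; subst.
    + apply (K y H2), in_upair; auto.
    + apply (K x H1), in_upair; auto.
Qed.

Lemma succ_inj m n : succ m = succ n -> m = n.
Proof.
  intros E.
  assert (H1 : m ∈ succ n) by (rewrite <- E; apply in_succ; auto).
  assert (H2 : n ∈ succ m) by (rewrite E; apply in_succ; auto).
  apply in_succ in H1; apply in_succ in H2.
  destruct H1 as [H1|]; [|assumption]. destruct H2 as [H2|]; [|auto].
  destruct (not_in_cycle H1 H2).
Qed.

Lemma omega_rec A z (G : M -> M) : Dterm (fun v => G (v 0)) ->
  z ∈ A -> (forall x, x ∈ A -> G x ∈ A) ->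
  exists h, is_fun h omega A /\ app h empty = z /\
    forall n, n ∈ omega -> app h (succ n) = G (app h n).
Proof.
  intros DG Hz HG.
  (* The graph is the intersection, within [cprod omega A], of all sets that contain the initial
     pair and are closed under the recursion step. *)
  pose (Q := fun p => p ∈ cprod omega A /\ forall c, opair empty z ∈ c ->
    (forall n x, n ∈ omega -> x ∈ A -> opair n x ∈ c -> opair (succ n) (G x) ∈ c) -> p ∈ c).
  assert (Hh : forall p, p ∈ setof Q <-> Q p).
  { apply in_sep with (a := cprod omega A); [unfold Q; definable | unfold Q; tauto]. }
  set (h := setof Q) in *.
  assert (h0 : opair empty z ∈ h).
  { apply Hh; split; [apply opair_in_cprod; auto using omega_0 | auto]. }
  assert (hS : forall n x, opair n x ∈ h -> opair (succ n) (G x) ∈ h).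
  { intros n x Hn; apply Hh in Hn; destruct Hn as [Hn K]. apply opair_in_cprod in Hn.
    apply Hh; split; [apply opair_in_cprod; split; [apply omega_S|apply HG]; tauto|].
    intros c c0 cS; apply cS; [tauto..|]. apply K; assumption. }
  (* Minimality of [h], as an induction principle along the graph. *)
  assert (hmin : forall (P : M -> Prop), Dprop (fun v => P (v 0)) -> P (opair empty z) ->
    (forall n x, opair n x ∈ h -> P (opair n x) -> P (opair (succ n) (G x))) ->
    forall p, p ∈ h -> P p).
  { intros P DP P0 PS p Hp.
    assert (Hc : forall p, p ∈ setof (fun p => p ∈ h /\ P p) <-> p ∈ h /\ P p).
    { apply in_sep with (a := h); [definable | tauto]. }
    apply Hc. apply Hh in Hp; destruct Hp as [_ Hp]; apply Hp.
    - apply Hc; auto.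
    - intros n x _ _ H; apply Hc in H; destruct H as [H1 H2]; apply Hc; auto. }
  assert (Hfun : is_fun h omega A).
  { split; [intros p Hp; apply Hh in Hp; exact (proj1 Hp)|].
    apply (@omega_ind (fun n => exists! y, opair n y ∈ h)); [definable | |].
    - exists z; split; [exact h0|]. intros y Hy.
      (* Inversion on membership in the graph: the pair is generalized so that [hmin] applies, and a
         pair produced by a step has a successor as first component. *)
      assert (K : forall x, opair empty y = opair empty x -> x = z).
      { revert Hy; generalize (opair empty y).
        apply (hmin (fun p => forall x, p = opair empty x -> x = z)); [definable| |].
        - intros x E; apply opair_inj in E; symmetry; tauto.
        - intros n x _ _ w E; apply opair_inj in E; destruct E as [E _].
          destruct (succ_neq_0 E). }
      symmetry; apply K; reflexivity.
    - intros n Hn (y & Hy & U). exists (G y); split; [apply hS, Hy|]. intros w Hw.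
      assert (K : forall x, opair (succ n) w = opair (succ n) x -> x = G y).
      { revert Hw; generalize (opair (succ n) w).
        apply (hmin (fun p => forall x, p = opair (succ n) x -> x = G y)); [definable| |].
        - intros x E; apply opair_inj in E; destruct E as [E _]. symmetry in E.
          destruct (succ_neq_0 E).
        - intros m x Hm _ u E; apply opair_inj in E; destruct E as [E <-].
          apply succ_inj in E; subst. rewrite (U x Hm); reflexivity. }
      symmetry; apply K; reflexivity. }
  exists h; split; [exact Hfun|]; split; [apply (fun_eq Hfun h0)|].
  intros n Hn; apply (fun_eq Hfun), hS, (fun_graph Hfun Hn).
Qed.

Lemma omega_fun_ext (G : M -> M) g h A B :
  is_fun g omega A -> is_fun h omega B -> app g empty = app h empty ->
  Dterm (fun v => G (v 0)) ->
  (forall n, n ∈ omega -> app g (succ n) = G (app g n)) ->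
  (forall n, n ∈ omega -> app h (succ n) = G (app h n)) -> g = h.
Proof.
  intros Hg Hh E0 DG gS hS. apply (fun_ext Hg Hh).
  apply (@omega_ind (fun n => app g n = app h n)); [definable | exact E0 |].
  intros n Hn E; rewrite gS, hS, E; auto.
Qed.

(** [nat_add] is a description, so existence and uniqueness are due. For each [m] the iteration of
    [succ] from [m] is unique; these functions can therefore be assembled by [the], without a
    choice. *)
Lemma nat_add_spec : is_fun nat_add (cprod omega omega) (@omega M) /\
  forall m, m ∈ omega -> app2 nat_add m empty = m /\
    forall n, n ∈ omega -> app2 nat_add m (succ n) = succ (app2 nat_add m n).
Proof.
  pose (H := fun m h => is_fun h omega omega /\ app h empty = m /\
    forall n, n ∈ omega -> app h (succ n) = succ (app h n)).
  assert (Hu : forall m, m ∈ omega -> exists! h, H m h).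
  { intros m Hm. destruct (@omega_rec omega m succ) as (h & h1 & h2 & h3);
      [definable | exact Hm | apply omega_S |].
    exists h; split; [unfold H; auto|]. intros g (g1 & g2 & g3).
    apply omega_fun_ext with (G := succ) (A := omega) (B := omega); auto; [congruence | definable]. }
  pose (F := fun q => app (the (H (pr1 q))) (pr2 q)).
  assert (DF : Dterm (fun v => F (v 0))) by (unfold F, H; definable).
  assert (HF : forall q, q ∈ cprod omega omega -> F q ∈ omega).
  { intros q Hq; apply in_cprod in Hq; destruct Hq as (m & n & Hm & Hn & ->).
    unfold F; rewrite pr1_opair, pr2_opair. pose proof (the_spec (Hu m Hm)) as [K _].
    apply (fun_app K Hn). }
  unfold nat_add.
  set (P := fun p => is_fun p (cprod omega omega) omega /\
    forall m, m ∈ omega -> app2 p m empty = m /\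
    forall n, n ∈ omega -> app2 p m (succ n) = succ (app2 p m n)).
  apply (@the_spec M P). exists (lam (cprod omega omega) F); split.
  - split; [exact (lam_fun DF HF)|]. intros m Hm. pose proof (the_spec (Hu m Hm)) as (K1 & K2 & K3).
    assert (E : forall n, n ∈ omega -> app2 (lam (cprod omega omega) F) m n = app (the (H m)) n).
    { intros n Hn; unfold app2; rewrite (app_lam DF HF) by (apply opair_in_cprod; auto).
      unfold F; rewrite pr1_opair, pr2_opair; reflexivity. }
    rewrite E by apply omega_0. split; [exact K2|].
    intros n Hn; rewrite !E by auto using omega_S. apply K3, Hn.
  - intros p [p1 p2]. apply (fun_ext (lam_fun DF HF) p1).
    intros q Hq; pose proof Hq as Hq'; apply in_cprod in Hq'; destruct Hq' as (m & n & Hm & Hn & ->).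
    rewrite (app_lam DF HF Hq); unfold F; rewrite pr1_opair, pr2_opair.
    pose proof (the_spec (Hu m Hm)) as (K1 & K2 & K3). destruct (p2 m Hm) as [q0 qS].
    clear Hq. revert n Hn.
    apply (@omega_ind (fun n => app (the (H m)) n = app p (opair m n))); [unfold H; definable| |].
    + rewrite K2; symmetry; exact q0.
    + intros n Hn E. rewrite K3, E by exact Hn. symmetry; apply qS, Hn.
Qed.

Definition plus m n := app2 nat_add m n.

Lemma plus_in m n : m ∈ omega -> n ∈ omega -> plus m n ∈ omega.
Proof. intros; apply (fun_app (proj1 nat_add_spec)), opair_in_cprod; auto. Qed.
Lemma plus_0 m : m ∈ omega -> plus m empty = m.
Proof. intros Hm; exact (proj1 (proj2 nat_add_spec m Hm)). Qed.
Lemma plus_S m n : m ∈ omega -> n ∈ omega -> plus m (succ n) = succ (plus m n).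
Proof. intros Hm; exact (proj2 (proj2 nat_add_spec m Hm) n). Qed.

Hint Resolve plus_in omega_0 omega_S : core.

Lemma D_plus : Dterm (fun v => plus (v 0) (v 1)).
Proof. unfold plus; definable. Qed.

Lemma plus_0_l n : n ∈ omega -> plus empty n = n.
Proof.
  revert n; apply (@omega_ind (fun n => plus empty n = n)); [unfold plus; definable| |].
  - apply plus_0; auto.
  - intros n Hn E; rewrite plus_S, E; auto.
Qed.

Lemma plus_S_l m n : m ∈ omega -> n ∈ omega -> plus (succ m) n = succ (plus m n).
Proof.
  intros Hm; revert n.
  apply (@omega_ind (fun n => plus (succ m) n = succ (plus m n))); [unfold plus; definable| |].
  - rewrite !plus_0; auto.
  - intros n Hn E; rewrite !plus_S, E; auto.
Qed.

Lemma plus_comm m n : m ∈ omega -> n ∈ omega -> plus m n = plus n m.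
Proof.
  intros Hm; revert n.
  apply (@omega_ind (fun n => plus m n = plus n m)); [unfold plus; definable| |].
  - rewrite plus_0, plus_0_l; auto.
  - intros n Hn E; rewrite plus_S, plus_S_l, E; auto.
Qed.

Lemma plus_assoc m n k : m ∈ omega -> n ∈ omega -> k ∈ omega ->
  plus m (plus n k) = plus (plus m n) k.
Proof.
  intros Hm Hn; revert k.
  apply (@omega_ind (fun k => plus m (plus n k) = plus (plus m n) k));
    [unfold plus; definable| |].
  - rewrite !plus_0; auto.
  - intros k Hk E; rewrite !plus_S, E; auto.
Qed.

Lemma plus_cancel_r m n k : m ∈ omega -> n ∈ omega -> k ∈ omega ->
  plus m k = plus n k -> m = n.
Proof.
  intros Hm Hn; revert k.
  apply (@omega_ind (fun k => plus m k = plus n k -> m = n)); [unfold plus; definable| |].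
  - rewrite !plus_0; auto.
  - intros k Hk E; rewrite !plus_S by auto. intros K; apply succ_inj in K; auto.
Qed.

Lemma plus_cancel_l m n k : m ∈ omega -> n ∈ omega -> k ∈ omega ->
  plus k m = plus k n -> m = n.
Proof.
  intros Hm Hn Hk; rewrite (plus_comm Hk Hm), (plus_comm Hk Hn). apply plus_cancel_r; auto.
Qed.

Lemma omega_cases n : n ∈ omega -> n = empty \/ exists k, k ∈ omega /\ n = succ k.
Proof.
  revert n; apply (@omega_ind (fun n => n = empty \/ exists k, k ∈ omega /\ n = succ k));
    [definable | auto | eauto].
Qed.

Lemma plus_eq_0 m n : m ∈ omega -> n ∈ omega -> plus m n = empty -> m = empty /\ n = empty.
Proof.
  intros Hm Hn E. destruct (omega_cases Hn) as [-> | (k & Hk & ->)].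
  - rewrite plus_0 in E; auto.
  - rewrite plus_S in E by auto. destruct (succ_neq_0 E).
Qed.

(** Comparability, with the order on [omega] expressed through sums. *)
Lemma plus_total m n : m ∈ omega -> n ∈ omega ->
  exists k, k ∈ omega /\ (m = plus n k \/ n = plus m k).
Proof.
  intros Hm; revert n.
  apply (@omega_ind (fun n => exists k, k ∈ omega /\ (m = plus n k \/ n = plus m k)));
    [unfold plus; definable| |].
  - exists m; rewrite plus_0_l; auto.
  - intros n Hn (k & Hk & [E|E]).
    + destruct (omega_cases Hk) as [-> | (j & Hj & ->)].
      * exists (succ empty); split; [auto|]; right.
        rewrite E, !plus_0, plus_S, plus_0; auto.
      * exists j; split; [auto|]; left. rewrite plus_S_l, <- plus_S; auto.
    + exists (succ k); split; [auto|]; right. rewrite plus_S, E; auto.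
Qed.
End Omega.

#[export] Hint Resolve plus_in omega_0 omega_S : core.

Ltac def_nat :=
  match goal with
  | |- Dterm (fun v => plus _ _) => apply (@Dterm_congr2 _ _ (@D_plus _))
  | _ => def_ops
  end.
Ltac def_hook ::= def_nat.

(** * Finite sets *)

Section Finite.
Context {M : ZF_model}.
Implicit Types e m n k x y A B K : M.

Lemma bij_inj e A B x y : is_bij e A B -> x ∈ A -> y ∈ A -> app e x = app e y -> x = y.
Proof.
  intros [Hf He] Hx Hy E. destruct (He (app e x) (fun_app Hf Hx)) as (z & _ & U).
  rewrite <- (U x), <- (U y); auto.
Qed.

Lemma bij_surj e A B y : is_bij e A B -> y ∈ B -> exists x, x ∈ A /\ app e x = y.
Proof. intros [_ He] Hy; destruct (He y Hy) as (x & Hx & _); eauto. Qed.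

Lemma is_fun_mono f A B C : @is_fun M f A B -> sub B C -> is_fun f A C.
Proof.
  intros Hf HC; split; [|exact (proj2 Hf)].
  intros p Hp; destruct (fun_in Hf Hp) as (x & Hx & ->).
  apply opair_in_cprod; split; [exact Hx | apply HC, (fun_app Hf Hx)].
Qed.

Lemma bij_insert e A B x y : is_bij e A B -> ~ x ∈ A -> ~ y ∈ B ->
  is_bij (insert e (opair x y)) (insert A x) (insert B y).
Proof.
  intros He Hx Hy.
  destruct (@fun_insert M e A (insert B y) x y) as (F1 & F2 & F3).
  - apply is_fun_mono with (B := B); [apply He|]. intros z Hz; apply in_insert; auto.
  - exact Hx.
  - apply in_insert; auto.
  - split; [exact F1|]. intros z Hz; apply in_insert in Hz; destruct Hz as [Hz| ->].
    + destruct (bij_surj He Hz) as (u & Hu & E). exists u; split.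
      * rewrite F3, in_insert by exact Hu; auto.
      * intros w [Hw E']. apply in_insert in Hw; destruct Hw as [Hw| ->].
        -- rewrite F3 in E' by exact Hw. apply (bij_inj He); congruence.
        -- rewrite F2 in E'; subst; tauto.
    + exists x; split; [rewrite in_insert, F2; auto|].
      intros w [Hw E']. apply in_insert in Hw; destruct Hw as [Hw| ->]; [|reflexivity].
      rewrite F3 in E' by exact Hw. subst; destruct Hy. apply (fun_app (proj1 He) Hw).
Qed.

Lemma bij_restrict e A B x : is_bij e (insert A x) B -> ~ x ∈ A ->
  is_bij (lam A (fun z => app e z)) A (remove B (app e x)) /\
  forall z, z ∈ A -> app (lam A (fun z => app e z)) z = app e z.
Proof.
  intros He Hx.
  assert (xA : x ∈ insert A x) by (apply in_insert; auto).
  assert (AA : sub A (insert A x)) by (intros z Hz; apply in_insert; auto).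
  destruct (@fun_restrict M e (insert A x) B A (remove B (app e x))) as [F1 F2].
  - apply He.
  - exact AA.
  - intros z Hz; apply in_remove; split; [apply (fun_app (proj1 He)); auto|].
    intros E. apply Hx. rewrite <- (bij_inj He (AA z Hz) xA E); exact Hz.
  - split; [|exact F2]. split; [exact F1|].
    intros y Hy; apply in_remove in Hy; destruct Hy as [Hy Ny].
    destruct (bij_surj He Hy) as (z & Hz & E).
    apply in_insert in Hz; destruct Hz as [Hz| ->]; [|congruence].
    exists z; split; [rewrite F2; auto|].
    intros w [Hw E']; rewrite F2 in E' by exact Hw. apply (bij_inj He); auto; congruence.
Qed.

Lemma bij_empty : is_bij (@empty M) empty empty.
Proof.
  split; [split|]; intros x Hx; destruct (in_empty Hx).
Qed.

Lemma bij_empty_eq e B : is_bij e empty B -> B = empty.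
Proof.
  intros He; apply eq_empty; intros y Hy.
  destruct (bij_surj He Hy) as (x & Hx & _); exact (in_empty Hx).
Qed.

Lemma finite_empty : finite (@empty M).
Proof. exists empty, empty; split; [apply omega_0 | apply bij_empty]. Qed.

Lemma finite_insert K x : finite K -> finite (insert K x).
Proof.
  intros (n & e & Hn & He). destruct (classic (x ∈ K)) as [Hx|Hx].
  - exists n, e; split; [exact Hn|]. replace (insert K x) with K; [exact He|].
    apply set_ext; intros y; rewrite in_insert; split; [auto | intros [| ->]; auto].
  - exists (succ n), (insert e (opair n x)); split; [auto|].
    apply (bij_insert He (@not_in_self M n) Hx).
Qed.

(** Induction on the length of an enumeration, removing its last value. [succ n] is convertible to
    [insert n n], the form that [bij_restrict] expects. *)
Lemma finite_ind (P : M -> Prop) : Dprop (fun v => P (v 0)) -> P empty ->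
  (forall K x, finite K -> ~ x ∈ K -> P K -> P (insert K x)) ->
  forall K, finite K -> P K.
Proof.
  intros DP P0 PS K (n & e & Hn & He). revert n Hn K e He.
  apply (@omega_ind M (fun n => forall K e, is_bij e n K -> P K)); [definable| |].
  - intros K e He; rewrite (bij_empty_eq He); exact P0.
  - intros n Hn IH K e He. destruct (bij_restrict He (@not_in_self M n)) as [H1 _].
    assert (Ke : app e n ∈ K) by (apply (fun_app (proj1 He)), in_succ; auto).
    rewrite <- (insert_remove Ke). apply PS.
    + eexists n, _; eauto.
    + rewrite in_remove; tauto.
    + eapply IH; eassumption.
Qed.

Lemma finite_cup A B : finite A -> finite B -> finite (cup A B).
Proof.
  intros HA HB; revert A HA. apply finite_ind; [definable| |].
  - replace (cup empty B) with B; [exact HB|].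
    apply set_ext; intros x; rewrite in_cup. split; [auto | intros [H|H]; [destruct (in_empty H)|auto]].
  - intros A x _ _ H. replace (cup (insert A x) B) with (insert (cup A B) x).
    + apply finite_insert, H.
    + apply set_ext; intros y; rewrite in_cup, !in_insert, in_cup; tauto.
Qed.

Lemma finite_sub A B : finite B -> sub A B -> finite A.
Proof.
  intros HB; revert B HB A.
  apply (@finite_ind (fun B => forall A, sub A B -> finite A)); [definable| |].
  - intros A H; replace A with (@empty M); [apply finite_empty|]. symmetry; apply eq_empty.
    intros x Hx; exact (in_empty (H x Hx)).
  - intros B x _ _ IH A H.
    assert (HR : finite (remove A x)).
    { apply IH; intros y Hy; apply in_remove in Hy; destruct Hy as [Hy Ny].
      apply H, in_insert in Hy; tauto. }
    destruct (classic (x ∈ A)) as [Hx|Hx].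
    + rewrite <- (insert_remove Hx); apply finite_insert, HR.
    + replace A with (remove A x); [exact HR|].
      apply set_ext; intros y; rewrite in_remove. split; [tauto|]. intros Hy; split; [exact Hy|congruence].
Qed.

Lemma finite_sing x : finite (upair x x).
Proof.
  replace (upair x x) with (insert empty x); [apply finite_insert, finite_empty|].
  apply set_ext; intros y; rewrite in_insert, in_upair.
  split; [intros [H|H]; [destruct (in_empty H)|auto] | tauto].
Qed.

Lemma finite_bigcup (F : M -> M) A : Dterm (fun v => F (v 0)) -> finite A ->
  (forall x, x ∈ A -> finite (F x)) ->
  exists s, finite s /\ forall y, y ∈ s <-> exists x, x ∈ A /\ y ∈ F x.
Proof.
  intros DF HA; revert A HA. apply (@finite_ind (fun A => (forall x, x ∈ A -> finite (F x)) ->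
    exists s, finite s /\ forall y, y ∈ s <-> exists x, x ∈ A /\ y ∈ F x)); [definable| |].
  - intros _; exists empty; split; [apply finite_empty|].
    intros y; split; [intros H; destruct (in_empty H) | intros (x & H & _); destruct (in_empty H)].
  - intros A x _ _ IH H. destruct IH as (s & Hs & K).
    { intros z Hz; apply H, in_insert; auto. }
    exists (cup s (F x)); split.
    + apply finite_cup; [exact Hs|]. apply H, in_insert; auto.
    + intros y; rewrite in_cup, K; split.
      * intros [(z & Hz & Hy)|Hy]; [exists z | exists x]; rewrite in_insert; auto.
      * intros (z & Hz & Hy); apply in_insert in Hz; destruct Hz as [Hz| ->]; eauto.
Qed.

Lemma finite_image (F : M -> M) A : Dterm (fun v => F (v 0)) -> finite A ->
  exists s, finite s /\ forall y, y ∈ s <-> exists x, x ∈ A /\ y = F x.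
Proof.
  intros DF HA. destruct (@finite_bigcup (fun x => upair (F x) (F x)) A) as (s & Hs & K).
  - definable.
  - exact HA.
  - intros; apply finite_sing.
  - exists s; split; [exact Hs|]. intros y; rewrite K.
    split; intros (x & Hx & E); exists x; (split; [exact Hx|]); [apply in_upair in E; tauto|].
    apply in_upair; auto.
Qed.

Lemma finite_cprod A B : finite A -> finite B -> finite (cprod A B).
Proof.
  intros HA HB; revert A HA. apply finite_ind; [definable| |].
  - replace (cprod empty B) with (@empty M); [apply finite_empty|].
    symmetry; apply eq_empty; intros p Hp; apply in_cprod in Hp.
    destruct Hp as (a & _ & Ha & _); exact (in_empty Ha).
  - intros A x _ _ IH.
    destruct (@finite_image (fun b => opair x b) B) as (s & Hs & K); [definable | exact HB|].
    apply finite_sub with (B := cup (cprod A B) s); [apply finite_cup; assumption|].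
    intros p Hp; apply in_cprod in Hp; destruct Hp as (a & b & Ha & Hb & ->).
    apply in_cup. apply in_insert in Ha; destruct Ha as [Ha| ->].
    + left; apply opair_in_cprod; auto.
    + right; apply K; eauto.
Qed.

Lemma finite_max (F : M -> M) A : Dterm (fun v => F (v 0)) -> finite A ->
  (forall x, x ∈ A -> F x ∈ omega) -> (exists x, x ∈ A) ->
  exists a, a ∈ A /\ forall b, b ∈ A -> exists k, k ∈ omega /\ F a = plus (F b) k.
Proof.
  intros DF HA; revert A HA. apply (@finite_ind (fun A => (forall x, x ∈ A -> F x ∈ omega) ->
    (exists x, x ∈ A) -> exists a, a ∈ A /\
    forall b, b ∈ A -> exists k, k ∈ omega /\ F a = plus (F b) k)); [definable| |].
  - intros _ [x Hx]; destruct (in_empty Hx).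
  - intros A x _ _ IH HF _.
    assert (Fx : F x ∈ omega) by (apply HF, in_insert; auto).
    assert (FA : forall y, y ∈ A -> F y ∈ omega) by (intros; apply HF, in_insert; auto).
    assert (Rx : exists k, k ∈ omega /\ F x = plus (F x) k).
    { exists empty; split; [auto | rewrite plus_0; auto]. }
    destruct (classic (exists y, y ∈ A)) as [E|E].
    + destruct (IH FA E) as (a & Ha & K).
      destruct (plus_total (FA a Ha) Fx) as (k & Hk & [E1|E1]).
      * exists a; split; [apply in_insert; auto|]. intros b Hb; apply in_insert in Hb.
        destruct Hb as [Hb| ->]; [auto | eauto].
      * exists x; split; [apply in_insert; auto|]. intros b Hb; apply in_insert in Hb.
        destruct Hb as [Hb| ->]; [|exact Rx].
        destruct (K b Hb) as (j & Hj & E2). exists (plus j k); split; [auto|].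
        rewrite E1, E2, plus_assoc; auto.
    + exists x; split; [apply in_insert; auto|]. intros b Hb; apply in_insert in Hb.
      destruct Hb as [Hb| ->]; [exfalso; eauto | exact Rx].
Qed.

(** Here [n] exceeds every [F x]. In the form chosen, with [F] the exponent of w, it says that no
    monomial considered is a multiple of the [n]-th power of w. *)
Lemma finite_bound (F : M -> M) A : Dterm (fun v => F (v 0)) -> finite A ->
  (forall x, x ∈ A -> F x ∈ omega) ->
  exists n, n ∈ omega /\ forall x k, x ∈ A -> k ∈ omega -> F x <> plus n k.
Proof.
  intros DF HA HF. destruct (classic (exists x, x ∈ A)) as [E|E].
  - destruct (finite_max DF HA HF E) as (a & Ha & K).
    exists (succ (F a)); split; [auto|]. intros x k Hx Hk E'.
    destruct (K x Hx) as (j & Hj & E1).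
    pose proof (HF a Ha) as Wa. pose proof (HF x Hx) as Wx.
    assert (E2 : plus (F a) empty = plus (F a) (succ (plus k j))).
    { rewrite plus_0 by auto. rewrite E1 at 1. rewrite E', <- plus_assoc, plus_S_l, plus_S; auto. }
    apply plus_cancel_l in E2; auto. symmetry in E2; exact (succ_neq_0 E2).
  - exists empty; split; [auto|]. intros x k Hx; exfalso; eauto.
Qed.
End Finite.

(** * Finite sums *)

Section CommRing.
Context {M : ZF_model} {R : ring M} (HR : is_comm_ring R).
Local Infix "+" := (radd R).
Local Infix "*" := (rmul R).
Local Notation C := (car R).
Implicit Types x y z u : M.

Lemma radd_in x y : x ∈ C -> y ∈ C -> x + y ∈ C.
Proof. intros; apply (fun_app (cr_addf HR)), opair_in_cprod; auto. Qed.

Lemma rmul_in x y : x ∈ C -> y ∈ C -> x * y ∈ C.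
Proof. intros; apply (fun_app (cr_mulf HR)), opair_in_cprod; auto. Qed.

Lemma rzero_in : zero R ∈ C.
Proof. exact (cr_zero HR). Qed.

Lemma rone_in : one R ∈ C.
Proof. exact (cr_one HR). Qed.

Hint Resolve radd_in rmul_in rzero_in rone_in : core.

Lemma radd_0_r x : x ∈ C -> x + zero R = x.
Proof. intros; rewrite (cr_addC HR x), (cr_add0 HR); auto. Qed.

Lemma radd_AC x y z : x ∈ C -> y ∈ C -> z ∈ C -> x + y + z = x + z + y.
Proof. intros; rewrite <- !(cr_addA HR), (cr_addC HR y z); auto. Qed.

Lemma radd_ACA x y z u : x ∈ C -> y ∈ C -> z ∈ C -> u ∈ C ->
  (x + y) + (z + u) = (x + z) + (y + u).
Proof. intros; rewrite !(cr_addA HR), (radd_AC (x := x)); auto. Qed.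

Lemma radd_cancel x y z : x ∈ C -> y ∈ C -> z ∈ C -> x + z = y + z -> x = y.
Proof.
  intros Hx Hy Hz E. destruct (cr_opp HR z Hz) as (w & Hw & E0).
  rewrite <- (radd_0_r Hx), <- (radd_0_r Hy), <- E0, !(cr_addA HR), E; auto.
Qed.

Lemma rmul_0_r x : x ∈ C -> x * zero R = zero R.
Proof.
  intros Hx. apply (@radd_cancel _ _ (x * zero R)); auto.
  rewrite <- (cr_distr HR), !(cr_add0 HR); auto.
Qed.

Lemma rmul_0_l x : x ∈ C -> zero R * x = zero R.
Proof. intros; rewrite (cr_mulC HR (zero R)), rmul_0_r; auto. Qed.

Lemma rmul_1_r x : x ∈ C -> x * one R = x.
Proof. intros; rewrite (cr_mulC HR x), (cr_mul1 HR); auto. Qed.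

Lemma rdistr_l x y z : x ∈ C -> y ∈ C -> z ∈ C -> (x + y) * z = x * z + y * z.
Proof.
  intros; rewrite (cr_mulC HR (x + y)), (cr_distr HR), (cr_mulC HR z x), (cr_mulC HR z y); auto.
Qed.

Section Rel.
Context {F : M -> M} (DF : Dterm (fun v => F (v 0))).

(** The relation described in [fsum], studied by itself until its value is known to be unique. *)
Definition sum_rel K v := exists n e t,
  n ∈ omega /\ is_bij e n K /\ is_fun t (succ n) C /\ app t empty = zero R /\
  (forall k, k ∈ n -> app t (succ k) = app t k + F (app e k)) /\ v = app t n.

Lemma sum_rel_in K v : sum_rel K v -> v ∈ C.
Proof.
  intros (n & e & t & Hn & _ & Ht & _ & _ & ->). apply (fun_app Ht), in_succ; auto.
Qed.

Lemma sum_rel_empty : sum_rel empty (zero R).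
Proof.
  destruct (@fun_insert M empty empty C empty (zero R)) as (F1 & F2 & _).
  - split; intros x Hx; destruct (in_empty Hx).
  - apply in_empty.
  - auto.
  - exists empty, empty; eexists.
    refine (conj omega_0 (conj bij_empty (conj F1 (conj F2 (conj _ (eq_sym F2)))))).
    intros k Hk; destruct (in_empty Hk).
Qed.

Lemma sum_rel_insert K v y :
  sum_rel K v -> ~ y ∈ K -> F y ∈ C -> sum_rel (insert K y) (v + F y).
Proof.
  intros HS Hy HF. pose proof (sum_rel_in HS) as Hv.
  destruct HS as (n & e & t & Hn & He & Ht & t0 & tS & ->).
  destruct (@fun_insert M t (succ n) C (succ n) (app t n + F y)) as (F1 & F2 & F3);
    [exact Ht | apply not_in_self | auto |].
  destruct (@fun_insert M e n (insert K y) n y) as (E1 & E2 & E3).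
  { apply is_fun_mono with (B := K); [apply He | intros z; rewrite in_insert; auto]. }
  { apply not_in_self. }
  { apply in_insert; auto. }
  exists (succ n), (insert e (opair n y)), (insert t (opair (succ n) (app t n + F y))).
  refine (conj _ (conj _ (conj F1 (conj _ (conj _ _)))));
    [auto | apply bij_insert; auto; apply not_in_self | | |].
  - rewrite F3; [exact t0 | apply empty_in_succ, Hn].
  - intros k Hk. assert (Sk : succ k ∈ succ n \/ k = n).
    { apply in_succ in Hk; destruct Hk as [Hk| ->]; auto using succ_in_succ. }
    destruct (classic (k = n)) as [->|N].
    + rewrite F2, E2, F3; [reflexivity | exact Hk].
    + apply in_succ in Hk; destruct Hk as [Hk|]; [|tauto]. destruct Sk as [Sk|]; [|tauto].
      rewrite (F3 _ Sk), F3, E3 by (try apply in_succ; auto). apply tS, Hk.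
  - symmetry; exact F2.
Qed.

Lemma sum_rel_ind (P : M -> M -> Prop) : Dprop (fun v => P (v 0) (v 1)) ->
  P empty (zero R) ->
  (forall K y v, sum_rel K v -> ~ y ∈ K -> P K v -> P (insert K y) (v + F y)) ->
  forall K v, sum_rel K v -> P K v.
Proof.
  intros DP P0 PS K v (n & e & t & Hn & He & Ht & t0 & tS & ->).
  revert n Hn K e t He Ht t0 tS.
  apply (@omega_ind M (fun n => forall K e t, is_bij e n K -> is_fun t (succ n) C ->
    app t empty = zero R ->
    (forall k, k ∈ n -> app t (succ k) = app t k + F (app e k)) -> P K (app t n)));
    [definable| |].
  - intros K e t He _ t0 _. rewrite (bij_empty_eq He), t0; exact P0.
  - intros n Hn IH K e t He Ht t0 tS.
    destruct (bij_restrict He (@not_in_self M n)) as [H1 H1'].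
    assert (Ke : app e n ∈ K) by (apply (fun_app (proj1 He)), in_succ; auto).
    destruct (@fun_restrict M t (succ (succ n)) C (succ n) C Ht) as [H2 H2'].
    { intros x Hx; apply in_succ; auto. }
    { intros x Hx; apply (fun_app Ht), in_succ; auto. }
    set (e' := lam n _) in *. set (t' := lam (succ n) _) in *.
    assert (n1 : n ∈ succ n) by (apply in_succ; auto).
    assert (t0' : app t' empty = zero R).
    { rewrite H2'; [exact t0 | apply empty_in_succ, Hn]. }
    assert (tS' : forall k, k ∈ n -> app t' (succ k) = app t' k + F (app e' k)).
    { intros k Hk. rewrite !H2', H1', tS; [reflexivity| | exact Hk | |].
      - apply in_succ; auto.
      - apply in_succ; auto.
      - apply succ_in_succ; assumption. }
    rewrite tS by exact n1. rewrite <- (insert_remove Ke). rewrite <- (H2' n n1). apply PS.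
    + exists n, e', t'; auto 10.
    + rewrite in_remove; tauto.
    + apply (IH _ e' t'); auto.
Qed.

(** Moves an arbitrary [x] to the end of an enumeration. *)
Lemma sum_rel_remove K v x : sum_rel K v -> (forall y, y ∈ K -> F y ∈ C) -> x ∈ K ->
  exists w, sum_rel (remove K x) w /\ v = w + F x.
Proof.
  intros HS; revert x; revert K v HS.
  apply (@sum_rel_ind (fun K v => forall x, (forall y, y ∈ K -> F y ∈ C) -> x ∈ K ->
    exists w, sum_rel (remove K x) w /\ v = w + F x)).
  - unfold sum_rel; definable.
  - intros x _ Hx; destruct (in_empty Hx).
  - intros K y v HS Hy IH x HF Hx.
    assert (Fy : F y ∈ C) by (apply HF, in_insert; auto).
    apply in_insert in Hx. destruct Hx as [Hx| ->].
    + destruct (IH x) as (w & Hw & ->); [|exact Hx|].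
      { intros z Hz; apply HF, in_insert; auto. }
      assert (Fx : F x ∈ C) by (apply HF, in_insert; auto).
      exists (w + F y); split; [|apply radd_AC; eauto using sum_rel_in].
      replace (remove (insert K y) x) with (insert (remove K x) y).
      * apply sum_rel_insert; [exact Hw | rewrite in_remove; tauto | exact Fy].
      * apply set_ext; intros z. rewrite in_insert, !in_remove, in_insert.
        split; [intros [|E]; [tauto|]; subst; split; [auto | congruence] | tauto].
    + exists v; split; [|reflexivity]. rewrite remove_insert; assumption.
Qed.

(** Induction along the first enumeration: its last element is moved to the end of the second one by
    [sum_rel_remove]. *)
Lemma sum_rel_unique K v w : (forall y, y ∈ K -> F y ∈ C) ->
  sum_rel K v -> sum_rel K w -> w = v.
Proof.
  intros HF HS; revert w; revert HF; revert K v HS.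
  apply (@sum_rel_ind (fun K v => (forall y, y ∈ K -> F y ∈ C) ->
    forall w, sum_rel K w -> w = v)).
  - unfold sum_rel; definable.
  - intros _ w (n & e & t & Hn & He & Ht & t0 & _ & ->).
    destruct (omega_cases Hn) as [-> | (k & Hk & ->)]; [exact t0|].
    destruct (in_empty (fun_app (proj1 He) (proj2 (in_succ k k) (or_intror eq_refl)))).
  - intros K y v HS Hy IH HF w Hw.
    destruct (@sum_rel_remove _ _ y Hw HF) as (u & Hu & ->); [apply in_insert; auto|].
    rewrite remove_insert in Hu by exact Hy. rewrite (IH (fun z Hz => HF z (proj2 (in_insert K y z) (or_introl Hz))) u Hu); reflexivity.
Qed.

Lemma sum_rel_exists K : finite K -> (forall y, y ∈ K -> F y ∈ C) -> exists v, sum_rel K v.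
Proof.
  revert K; apply (@finite_ind M (fun K => (forall y, y ∈ K -> F y ∈ C) ->
    exists v, sum_rel K v)).
  - unfold sum_rel; definable.
  - exists (zero R); apply sum_rel_empty.
  - intros K x _ Hx IH HF. destruct IH as [v Hv].
    { intros y Hy; apply HF, in_insert; auto. }
    exists (v + F x); apply sum_rel_insert; auto. apply HF, in_insert; auto.
Qed.

Lemma fsum_eq K v : (forall y, y ∈ K -> F y ∈ C) -> sum_rel K v -> fsum R K F = v.
Proof. intros HF Hv; apply the_eq; [exact Hv | intros w; apply sum_rel_unique; assumption]. Qed.

Lemma fsum_rel K : finite K -> (forall y, y ∈ K -> F y ∈ C) -> sum_rel K (fsum R K F).
Proof.
  intros HK HF; destruct (sum_rel_exists HK HF) as [v Hv]. rewrite (fsum_eq HF Hv); exact Hv.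
Qed.

Lemma fsum_in K : finite K -> (forall y, y ∈ K -> F y ∈ C) -> fsum R K F ∈ C.
Proof. intros HK HF; apply (sum_rel_in (fsum_rel HK HF)). Qed.

Lemma fsum_empty : fsum R empty F = zero R.
Proof. apply fsum_eq, sum_rel_empty; intros y Hy; destruct (in_empty Hy). Qed.

Lemma fsum_insert K x : finite K -> ~ x ∈ K -> (forall y, y ∈ insert K x -> F y ∈ C) ->
  fsum R (insert K x) F = fsum R K F + F x.
Proof.
  intros HK Hx HF. apply (fsum_eq HF). apply sum_rel_insert.
  - apply fsum_rel; [exact HK|]. intros y Hy; apply HF, in_insert; auto.
  - exact Hx.
  - apply HF, in_insert; auto.
Qed.

Lemma fsum_remove K x : finite K -> x ∈ K -> (forall y, y ∈ K -> F y ∈ C) ->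
  fsum R K F = fsum R (remove K x) F + F x.
Proof.
  intros HK Hx HF. rewrite <- fsum_insert.
  - rewrite insert_remove; auto.
  - apply finite_sub with (B := K); [exact HK|]. intros y; rewrite in_remove; tauto.
  - rewrite in_remove; tauto.
  - rewrite insert_remove; auto.
Qed.

Lemma fsum_sing x : F x ∈ C -> fsum R (upair x x) F = F x.
Proof.
  intros Hx. replace (upair x x) with (insert empty x).
  - rewrite fsum_insert, fsum_empty, (cr_add0 HR); auto using finite_empty.
    + apply in_empty.
    + intros y Hy; apply in_insert in Hy; destruct Hy as [Hy| ->]; [destruct (in_empty Hy)|auto].
  - apply set_ext; intros y; rewrite in_insert, in_upair.
    split; [intros [H|H]; [destruct (in_empty H)|auto] | tauto].
Qed.

(** Allows sums over different supports to be computed over one common range. *)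
Lemma fsum_extend K K' : finite K' -> sub K K' -> (forall x, x ∈ K' -> F x ∈ C) ->
  (forall x, x ∈ K' -> ~ x ∈ K -> F x = zero R) -> fsum R K F = fsum R K' F.
Proof.
  intros HK'; revert K. revert K' HK'.
  apply (@finite_ind M (fun K' => forall K, sub K K' -> (forall x, x ∈ K' -> F x ∈ C) ->
    (forall x, x ∈ K' -> ~ x ∈ K -> F x = zero R) -> fsum R K F = fsum R K' F));
    [definable| |].
  - intros K H _ _. replace K with (@empty M); [reflexivity|].
    symmetry; apply eq_empty; intros x Hx; exact (in_empty (H x Hx)).
  - intros K' x HK' Hx IH K HK HF H0.
    assert (I : sub K' (insert K' x)) by (intros y Hy; apply in_insert; auto).
    rewrite fsum_insert; auto.
    destruct (classic (x ∈ K)) as [Kx|Kx].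
    + rewrite (@fsum_remove K x), (IH (remove K x)); auto.
      * intros y Hy; apply in_remove in Hy. destruct Hy as [Hy Ny].
        apply HK, in_insert in Hy; tauto.
      * intros y Hy Ny. apply H0; [auto|]. intros N; apply Ny, in_remove; split; congruence.
      * apply finite_sub with (B := insert K' x); [apply finite_insert, HK' | exact HK].
    + rewrite (H0 x), radd_0_r, (IH K); auto.
      * intros y Hy. pose proof (HK y Hy) as H; apply in_insert in H.
        destruct H as [|E]; [assumption | congruence].
      * apply fsum_in; auto.
      * apply in_insert; auto.
Qed.
End Rel.

Lemma fsum_ext F G K : (forall x, x ∈ K -> F x = G x) -> fsum R K F = fsum R K G.
Proof.
  intros E; apply the_ext; intros v.
  split; intros (n & e & t & Hn & He & Ht & t0 & tS & Ev); exists n, e, t;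
    (refine (conj Hn (conj He (conj Ht (conj t0 (conj _ Ev)))))); intros k Hk;
    rewrite tS by exact Hk; [rewrite E | rewrite <- E]; auto; apply (fun_app (proj1 He) Hk).
Qed.

Lemma fsum_add F G K : Dterm (fun v => F (v 0)) -> Dterm (fun v => G (v 0)) -> finite K ->
  (forall x, x ∈ K -> F x ∈ C) -> (forall x, x ∈ K -> G x ∈ C) ->
  fsum R K (fun x => F x + G x) = fsum R K F + fsum R K G.
Proof.
  intros DF DG HK; revert K HK. apply (@finite_ind M (fun K => (forall x, x ∈ K -> F x ∈ C) ->
    (forall x, x ∈ K -> G x ∈ C) ->
    fsum R K (fun x => F x + G x) = fsum R K F + fsum R K G)); [definable| |].
  - intros _ _. rewrite !fsum_empty, (cr_add0 HR); auto. definable.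
  - intros K x HK Hx IH HF HG.
    assert (I : sub K (insert K x)) by (intros y Hy; apply in_insert; auto).
    assert (Ix : x ∈ insert K x) by (apply in_insert; auto).
    rewrite !fsum_insert; auto; [|definable]. rewrite IH; auto.
    apply radd_ACA; auto; apply fsum_in; auto.
Qed.

Lemma fsum_reindex G (phi : M -> M) K K' : Dterm (fun v => G (v 0)) ->
  Dterm (fun v => phi (v 0)) -> finite K ->
  (forall y, y ∈ K' <-> exists x, x ∈ K /\ y = phi x) ->
  (forall x y, x ∈ K -> y ∈ K -> phi x = phi y -> x = y) ->
  (forall x, x ∈ K' -> G x ∈ C) -> fsum R K' G = fsum R K (fun x => G (phi x)).
Proof.
  intros DG Dphi HK; revert K'. revert K HK. apply (@finite_ind M (fun K => forall K',
    (forall y, y ∈ K' <-> exists x, x ∈ K /\ y = phi x) ->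
    (forall x y, x ∈ K -> y ∈ K -> phi x = phi y -> x = y) ->
    (forall x, x ∈ K' -> G x ∈ C) -> fsum R K' G = fsum R K (fun x => G (phi x))));
    [definable| |].
  - intros K' H _ _. replace K' with (@empty M).
    + rewrite !fsum_empty; auto. definable.
    + symmetry; apply eq_empty; intros y Hy; apply H in Hy. destruct Hy as (x & Hx & _).
      exact (in_empty Hx).
  - intros K x HK Hx IH K' HK' Hinj HG.
    assert (I : sub K (insert K x)) by (intros y Hy; apply in_insert; auto).
    assert (Ix : x ∈ insert K x) by (apply in_insert; auto).
    assert (Kx : phi x ∈ K') by (apply HK'; eauto).
    assert (FK' : finite K').
    { destruct (@finite_image M phi (insert K x) Dphi (finite_insert x HK)) as (s & Hs & E).
      replace K' with s; [exact Hs|]. apply set_ext; intros y; rewrite E, HK'; tauto. }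
    rewrite (@fsum_remove G DG K' (phi x)), fsum_insert; auto.
    + rewrite (IH (remove K' (phi x))); auto.
      * intros y. rewrite in_remove, HK'. split.
        -- intros [(z & Hz & ->) N]. apply in_insert in Hz.
           destruct Hz as [Hz| ->]; [eauto | tauto].
        -- intros (z & Hz & ->); split; [eauto|]. intros E.
           apply Hx. rewrite <- (Hinj z x); auto.
      * intros y Hy; apply in_remove in Hy; apply HG; tauto.
    + definable.
    + intros y Hy; apply HG, HK'; eauto.
Qed.
End CommRing.

#[export] Hint Resolve radd_in rmul_in rzero_in rone_in : core.

(** * Polynomial rings *)

Section Monomials.
Context {M : ZF_model} {X : M}.
Local Notation Mon := (monomials X).
Implicit Types a b c x y n m : M.

Definition vars m : M := setof (fun x => x ∈ X /\ app m x <> empty).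

Lemma in_vars m x : x ∈ vars m <-> x ∈ X /\ app m x <> empty.
Proof. unfold vars; apply in_sep with (a := X); [definable | tauto]. Qed.

Lemma in_monomials m : m ∈ Mon <-> is_fun m X omega /\ finite (vars m).
Proof.
  unfold monomials, vars; apply in_sep with (a := pow (cprod X omega)); [definable|].
  intros x [H _]; apply (fun_in_pow H).
Qed.

Lemma mono_fun m : m ∈ Mon -> is_fun m X omega.
Proof. intros H; apply in_monomials in H; tauto. Qed.

Lemma mono_app m x : m ∈ Mon -> x ∈ X -> app m x ∈ omega.
Proof. intros H; apply (fun_app (mono_fun H)). Qed.

Hint Resolve mono_app : core.

Lemma mono_ext a b : a ∈ Mon -> b ∈ Mon -> (forall x, x ∈ X -> app a x = app b x) -> a = b.
Proof. intros Ha Hb; apply (fun_ext (mono_fun Ha) (mono_fun Hb)). Qed.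

Lemma mono_intro (F : M -> M) K : Dterm (fun v => F (v 0)) ->
  (forall x, x ∈ X -> F x ∈ omega) -> finite K ->
  (forall x, x ∈ X -> F x <> empty -> x ∈ K) ->
  lam X F ∈ Mon /\ forall x, x ∈ X -> app (lam X F) x = F x.
Proof.
  intros DF HF HK HS. pose proof (app_lam DF HF) as E. split; [|exact E].
  apply in_monomials; split; [exact (lam_fun DF HF)|]. apply finite_sub with (B := K); [exact HK|].
  intros x Hx; apply in_vars in Hx. rewrite E in Hx by tauto. apply HS; tauto.
Qed.

Lemma mono_mul_spec a b : a ∈ Mon -> b ∈ Mon ->
  mono_mul X a b ∈ Mon /\
  forall x, x ∈ X -> app (mono_mul X a b) x = plus (app a x) (app b x).
Proof.
  intros Ha Hb. apply (@mono_intro (fun x => plus (app a x) (app b x)) (cup (vars a) (vars b))).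
  - definable.
  - auto.
  - apply finite_cup; [apply in_monomials in Ha | apply in_monomials in Hb]; tauto.
  - intros x Hx N. apply in_cup; rewrite !in_vars.
    destruct (classic (app a x = empty)) as [E|E]; [|auto].
    destruct (classic (app b x = empty)) as [E'|E']; [|auto].
    destruct N; rewrite E, E', plus_0; auto.
Qed.

Lemma mono_mul_in a b : a ∈ Mon -> b ∈ Mon -> mono_mul X a b ∈ Mon.
Proof. intros; apply mono_mul_spec; assumption. Qed.

Lemma mono_mul_app a b x : a ∈ Mon -> b ∈ Mon -> x ∈ X ->
  app (mono_mul X a b) x = plus (app a x) (app b x).
Proof. intros; apply mono_mul_spec; assumption. Qed.

Lemma mono_one_spec : mono_one X ∈ Mon /\ forall x, x ∈ X -> app (mono_one X) x = empty.
Proof.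
  apply (@mono_intro (fun _ => empty) empty); [definable | auto | apply finite_empty | tauto].
Qed.

Lemma mono_one_in : mono_one X ∈ Mon.
Proof. apply mono_one_spec. Qed.

Lemma mono_one_app x : x ∈ X -> app (mono_one X) x = empty.
Proof. apply mono_one_spec. Qed.

Hint Resolve mono_mul_in mono_one_in : core.

Lemma mono_mul_comm a b : a ∈ Mon -> b ∈ Mon -> mono_mul X a b = mono_mul X b a.
Proof.
  intros Ha Hb; apply mono_ext; [auto|auto|]. intros x Hx. rewrite !mono_mul_app, plus_comm; auto.
Qed.

Lemma mono_mul_assoc a b c : a ∈ Mon -> b ∈ Mon -> c ∈ Mon ->
  mono_mul X a (mono_mul X b c) = mono_mul X (mono_mul X a b) c.
Proof.
  intros Ha Hb Hc; apply mono_ext; [auto|auto|]. intros x Hx. rewrite !mono_mul_app, plus_assoc; auto.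
Qed.

Lemma mono_mul_1 a : a ∈ Mon -> mono_mul X (mono_one X) a = a.
Proof.
  intros Ha; apply mono_ext; [auto|auto|].
  intros x Hx. rewrite mono_mul_app, mono_one_app, plus_0_l; auto.
Qed.

Lemma mono_mul_cancel a b c : a ∈ Mon -> b ∈ Mon -> c ∈ Mon ->
  mono_mul X c a = mono_mul X c b -> a = b.
Proof.
  intros Ha Hb Hc E; apply mono_ext; [auto|auto|].
  intros x Hx. apply (@plus_cancel_l M _ _ (app c x)); auto. rewrite <- !mono_mul_app, E; auto.
Qed.

(** It has the shape of the description inside [poly_const]; thus [poly_const R X c] is convertible
    to [term c (mono_one X)], and facts about terms cover the constants. *)
Definition ite (P : Prop) a b : M := the (fun v => (P /\ v = a) \/ (~ P /\ v = b)).

Lemma ite_true (P : Prop) a b : P -> ite P a b = a.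
Proof. intros H; apply the_eq; [auto | intros z; tauto]. Qed.

Lemma ite_false (P : Prop) a b : ~ P -> ite P a b = b.
Proof. intros H; apply the_eq; [auto | intros z; tauto]. Qed.

Definition mono_pow x n : M := lam X (fun y => ite (y = x) n empty).

Lemma mono_pow_spec x n : n ∈ omega -> mono_pow x n ∈ Mon /\
  forall y, y ∈ X -> app (mono_pow x n) y = ite (y = x) n empty.
Proof.
  intros Hn. apply (@mono_intro (fun y => ite (y = x) n empty) (upair x x)).
  - unfold ite; definable.
  - intros y _. destruct (classic (y = x)); [rewrite ite_true | rewrite ite_false]; auto.
  - apply finite_sing.
  - intros y _ N. apply in_upair; left. apply NNPP; intros N'; apply N, ite_false, N'.
Qed.

Lemma mono_pow_in x n : n ∈ omega -> mono_pow x n ∈ Mon.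
Proof. intros; apply mono_pow_spec; assumption. Qed.

Lemma mono_pow_eq x n : n ∈ omega -> x ∈ X -> app (mono_pow x n) x = n.
Proof. intros Hn Hx; rewrite (proj2 (mono_pow_spec x Hn) x Hx); apply ite_true; reflexivity. Qed.

Lemma mono_pow_neq x y n : n ∈ omega -> y ∈ X -> y <> x -> app (mono_pow x n) y = empty.
Proof. intros Hn Hy N; rewrite (proj2 (mono_pow_spec x Hn) y Hy); apply ite_false, N. Qed.
End Monomials.

#[export] Hint Resolve mono_app mono_mul_in mono_one_in mono_pow_in : core.
Arguments vars {M} X m.
Arguments mono_pow {M} X x n.

(** * Coefficients, convolution product and ring laws of polynomials *)

Section Polynomials.
Context {M : ZF_model} {R : ring M} (HR : is_comm_ring R) {X : M}.
Local Notation Mon := (monomials X).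
Local Notation P := (polys R X).
Local Infix "+" := (radd R).
Local Infix "*" := (rmul R).
Local Notation C := (car R).
Implicit Types a b c d f g h m n A B K : M.


Lemma in_supp f m : m ∈ supp R X f <-> m ∈ Mon /\ app f m <> zero R.
Proof. unfold supp; apply in_sep with (a := Mon); [definable | tauto]. Qed.

Lemma in_polys f : f ∈ P <-> is_fun f Mon C /\ finite (supp R X f).
Proof.
  unfold polys; apply in_sep with (a := pow (cprod Mon C)); [definable|].
  intros x [H _]; apply (fun_in_pow H).
Qed.

Lemma poly_fun f : f ∈ P -> is_fun f Mon C.
Proof. intros H; apply in_polys in H; tauto. Qed.

Lemma supp_finite f : f ∈ P -> finite (supp R X f).
Proof. intros H; apply in_polys in H; tauto. Qed.

Lemma supp_mono f : sub (supp R X f) Mon.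
Proof. intros m Hm; apply in_supp in Hm; tauto. Qed.

Lemma coef_in f m : f ∈ P -> m ∈ Mon -> app f m ∈ C.
Proof. intros H; apply (fun_app (poly_fun H)). Qed.

Hint Resolve coef_in supp_finite : core.

Lemma coef_0 f m : m ∈ Mon -> ~ m ∈ supp R X f -> app f m = zero R.
Proof. intros Hm N; apply NNPP; intros E; apply N, in_supp; auto. Qed.

Lemma poly_ext f g : f ∈ P -> g ∈ P -> (forall m, m ∈ Mon -> app f m = app g m) -> f = g.
Proof. intros Hf Hg; apply (fun_ext (poly_fun Hf) (poly_fun Hg)). Qed.

Lemma poly_intro (F : M -> M) K : Dterm (fun v => F (v 0)) ->
  (forall m, m ∈ Mon -> F m ∈ C) -> finite K ->
  (forall m, m ∈ Mon -> F m <> zero R -> m ∈ K) ->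
  lam Mon F ∈ P /\ forall m, m ∈ Mon -> app (lam Mon F) m = F m.
Proof.
  intros DF HF HK HS. pose proof (app_lam DF HF) as E. split; [|exact E].
  apply in_polys; split; [exact (lam_fun DF HF)|]. apply finite_sub with (B := K); [exact HK|].
  intros x Hx; apply in_supp in Hx. rewrite E in Hx by tauto. apply HS; tauto.
Qed.

Lemma poly_add_spec f g : f ∈ P -> g ∈ P -> poly_add R X f g ∈ P /\
  forall m, m ∈ Mon -> app (poly_add R X f g) m = app f m + app g m.
Proof.
  intros Hf Hg.
  apply (@poly_intro (fun m => app f m + app g m) (cup (supp R X f) (supp R X g))).
  - definable.
  - auto.
  - apply finite_cup; auto.
  - intros m Hm N. apply in_cup; rewrite !in_supp.
    destruct (classic (app f m = zero R)) as [E|E]; [|auto].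
    destruct (classic (app g m = zero R)) as [E'|E']; [|auto].
    destruct N; rewrite E, E', (cr_add0 HR); auto.
Qed.

Lemma poly_add_in f g : f ∈ P -> g ∈ P -> poly_add R X f g ∈ P.
Proof. intros; apply poly_add_spec; assumption. Qed.

Lemma poly_add_app f g m : f ∈ P -> g ∈ P -> m ∈ Mon ->
  app (poly_add R X f g) m = app f m + app g m.
Proof. intros; apply poly_add_spec; assumption. Qed.

Definition term c a : M := lam Mon (fun m => ite (m = a) c (zero R)).

Lemma term_spec c a : c ∈ C -> term c a ∈ P /\
  forall m, m ∈ Mon -> app (term c a) m = ite (m = a) c (zero R).
Proof.
  intros Hc. apply (@poly_intro (fun m => ite (m = a) c (zero R)) (upair a a)).
  - unfold ite; definable.
  - intros m _. destruct (classic (m = a)); [rewrite ite_true | rewrite ite_false]; auto.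
  - apply finite_sing.
  - intros m _ N. apply in_upair; left. apply NNPP; intros N'; apply N, ite_false, N'.
Qed.

Lemma term_in c a : c ∈ C -> term c a ∈ P.
Proof. intros; apply term_spec; assumption. Qed.

Lemma term_eq c a : c ∈ C -> a ∈ Mon -> app (term c a) a = c.
Proof. intros Hc Ha; rewrite (proj2 (term_spec a Hc) a Ha); apply ite_true; reflexivity. Qed.

Lemma term_neq c a m : c ∈ C -> m ∈ Mon -> m <> a -> app (term c a) m = zero R.
Proof. intros Hc Hm N; rewrite (proj2 (term_spec a Hc) m Hm); apply ite_false, N. Qed.

Hint Resolve poly_add_in term_in : core.

Definition factors A B m : M :=
  setof (fun p => exists a b, a ∈ A /\ b ∈ B /\ mono_mul X a b = m /\ p = opair a b).

Lemma in_factors A B m p : p ∈ factors A B m <->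
  exists a b, a ∈ A /\ b ∈ B /\ mono_mul X a b = m /\ p = opair a b.
Proof.
  unfold factors; apply in_sep with (a := cprod A B); [definable|].
  intros q (a & b & Ha & Hb & _ & ->); apply opair_in_cprod; auto.
Qed.

Lemma factors_finite A B m : finite A -> finite B -> finite (factors A B m).
Proof.
  intros HA HB; apply finite_sub with (B := cprod A B); [apply finite_cprod; assumption|].
  intros p Hp; apply in_factors in Hp; destruct Hp as (a & b & Ha & Hb & _ & ->).
  apply opair_in_cprod; auto.
Qed.

Definition conv f g A B m : M :=
  fsum R (factors A B m) (fun p => app f (pr1 p) * app g (pr2 p)).

Lemma conv_prod_in f g A B m p : f ∈ P -> g ∈ P -> sub A Mon -> sub B Mon ->
  p ∈ factors A B m -> app f (pr1 p) * app g (pr2 p) ∈ C.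
Proof.
  intros Hf Hg HA HB Hp; apply in_factors in Hp; destruct Hp as (a & b & Ha & Hb & _ & ->).
  rewrite pr1_opair, pr2_opair; auto.
Qed.

Hint Resolve conv_prod_in factors_finite supp_mono : core.

Lemma conv_in f g A B m : f ∈ P -> g ∈ P -> sub A Mon -> sub B Mon ->
  finite A -> finite B -> conv f g A B m ∈ C.
Proof. intros; apply fsum_in; eauto; definable. Qed.

Lemma poly_mul_supp f g : f ∈ P -> g ∈ P -> poly_mul R X f g ∈ P /\
  forall m, m ∈ Mon -> app (poly_mul R X f g) m = conv f g (supp R X f) (supp R X g) m.
Proof.
  intros Hf Hg.
  destruct (@finite_image M (fun p => mono_mul X (pr1 p) (pr2 p))
    (cprod (supp R X f) (supp R X g))) as (s & Hs & Es).
  { definable. }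
  { apply finite_cprod; auto. }
  apply (@poly_intro (fun m => conv f g (supp R X f) (supp R X g) m) s).
  - unfold conv, factors; definable.
  - intros m _; apply conv_in; auto.
  - exact Hs.
  - intros m Hm N. apply NNPP; intros Nm. apply N. unfold conv.
    replace (factors _ _ m) with (@empty M); [apply fsum_empty; auto; definable|].
    symmetry; apply eq_empty; intros p Hp; apply in_factors in Hp.
    destruct Hp as (a & b & Ha & Hb & E & _). apply Nm, Es.
    exists (opair a b); rewrite pr1_opair, pr2_opair; split; [apply opair_in_cprod|]; auto.
Qed.

Lemma poly_mul_coef f g m : f ∈ P -> g ∈ P -> m ∈ Mon ->
  app (poly_mul R X f g) m = conv f g (supp R X f) (supp R X g) m.
Proof. intros Hf Hg; exact (proj2 (poly_mul_supp Hf Hg) m). Qed.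

Lemma poly_mul_in f g : f ∈ P -> g ∈ P -> poly_mul R X f g ∈ P.
Proof. intros; apply poly_mul_supp; assumption. Qed.

Hint Resolve poly_mul_in : core.

Lemma poly_mul_app f g A B m : f ∈ P -> g ∈ P -> m ∈ Mon ->
  finite A -> finite B -> sub A Mon -> sub B Mon ->
  sub (supp R X f) A -> sub (supp R X g) B ->
  app (poly_mul R X f g) m = conv f g A B m.
Proof.
  intros Hf Hg Hm FA FB AM BM HA HB. rewrite poly_mul_coef by assumption.
  apply fsum_extend; eauto.
  - definable.
  - intros p Hp; apply in_factors in Hp; destruct Hp as (a & b & Ha & Hb & E & Ep).
    apply in_factors; exists a, b; auto.
  - intros p Hp N; apply in_factors in Hp; destruct Hp as (a & b & Ha & Hb & E & ->).
    rewrite pr1_opair, pr2_opair.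
    destruct (classic (a ∈ supp R X f)) as [Sa|Sa].
    + destruct (classic (b ∈ supp R X g)) as [Sb|Sb].
      * destruct N; apply in_factors; exists a, b; auto.
      * rewrite (coef_0 (BM b Hb) Sb). apply (rmul_0_r HR); auto.
    + rewrite (coef_0 (AM a Ha) Sa). apply (rmul_0_l HR); auto.
Qed.

Lemma poly_mul_comm f g : f ∈ P -> g ∈ P -> poly_mul R X f g = poly_mul R X g f.
Proof.
  intros Hf Hg; apply poly_ext; [auto|auto|]. intros m Hm.
  rewrite !poly_mul_coef by auto. unfold conv.
  rewrite (@fsum_reindex M R HR _ (fun p => opair (pr2 p) (pr1 p))
    (factors (supp R X g) (supp R X f) m) (factors (supp R X f) (supp R X g) m)); eauto.
  - apply fsum_ext; auto. intros p Hp. pose proof (conv_prod_in Hg Hf (@supp_mono _) (@supp_mono _) Hp).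
    apply in_factors in Hp; destruct Hp as (a & b & Ha & Hb & _ & ->).
    rewrite !pr1_opair, !pr2_opair. apply (cr_mulC HR); apply coef_in; auto; eapply supp_mono; eauto.
  - definable.
  - definable.
  - intros p; rewrite in_factors; split.
    + intros (a & b & Ha & Hb & E & ->). exists (opair b a); rewrite pr1_opair, pr2_opair.
      split; [|reflexivity]. apply in_factors; exists b, a; repeat split; auto.
      rewrite mono_mul_comm; auto; eapply supp_mono; eauto.
    + intros (q & Hq & ->); apply in_factors in Hq; destruct Hq as (a & b & Ha & Hb & E & ->).
      rewrite pr1_opair, pr2_opair. exists b, a; repeat split; auto.
      rewrite mono_mul_comm; auto; eapply supp_mono; eauto.
  - intros p q Hp Hq E. apply in_factors in Hp; destruct Hp as (a & b & _ & _ & _ & ->).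
    apply in_factors in Hq; destruct Hq as (a' & b' & _ & _ & _ & ->).
    rewrite !pr1_opair, !pr2_opair in E. apply opair_inj in E; destruct E; subst; reflexivity.
Qed.

Lemma poly_mul_add f g h : f ∈ P -> g ∈ P -> h ∈ P ->
  poly_mul R X f (poly_add R X g h) = poly_add R X (poly_mul R X f g) (poly_mul R X f h).
Proof.
  intros Hf Hg Hh; apply poly_ext; [auto|auto|]. intros m Hm.
  set (A := supp R X f). set (B := cup (supp R X g) (supp R X h)).
  assert (FB : finite B) by (apply finite_cup; auto).
  assert (BM : sub B Mon).
  { intros b Hb; apply in_cup in Hb; destruct Hb as [Hb|Hb]; apply supp_mono in Hb; exact Hb. }
  assert (S1 : sub (supp R X g) B) by (intros b Hb; apply in_cup; auto).
  assert (S2 : sub (supp R X h) B) by (intros b Hb; apply in_cup; auto).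
  assert (S0 : sub A A) by (intros b Hb; exact Hb).
  assert (S3 : sub (supp R X (poly_add R X g h)) B).
  { intros b Hb. pose proof (supp_mono Hb) as Mb. apply in_supp in Hb; destruct Hb as [_ Hb].
    apply NNPP; intros N. apply Hb. rewrite poly_add_app, (@coef_0 g), (@coef_0 h), (cr_add0 HR); auto. }
  rewrite poly_add_app by auto.
  assert (FA : finite A) by (apply supp_finite, Hf).
  assert (AM : sub A Mon) by apply supp_mono.
  rewrite !(@poly_mul_app f _ A B) by auto.
  unfold conv; rewrite <- fsum_add; eauto.
  - apply fsum_ext; auto. intros p Hp; apply in_factors in Hp.
    destruct Hp as (a & b & Ha & Hb & _ & ->). rewrite !pr1_opair, !pr2_opair.
    rewrite poly_add_app by auto. apply supp_mono in Ha. apply (cr_distr HR); auto.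
  - definable.
  - definable.
Qed.

(** Monomials cancel, so (a, b) is the only factorization that contributes. *)
Lemma term_mul_app c a g b : c ∈ C -> a ∈ Mon -> g ∈ P -> b ∈ Mon ->
  app (poly_mul R X (term c a) g) (mono_mul X a b) = c * app g b.
Proof.
  intros Hc Ha Hg Hb.
  assert (Sa : sub (supp R X (term c a)) (upair a a)).
  { intros m Hm; apply in_supp in Hm; destruct Hm as [Mm Hm]. apply in_upair; left.
    apply NNPP; intros N; apply Hm, term_neq; auto. }
  assert (Ma : sub (upair a a) Mon) by (intros m Hm; apply in_upair in Hm; destruct Hm; subst; auto).
  (* The ranges contain a and b even if [c] or the coefficient of [g] at b is zero, so that exactly
     one factorization remains. *)
  rewrite (@poly_mul_app (term c a) g (upair a a) (insert (supp R X g) b)); auto using finite_sing, finite_insert.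
  - unfold conv. replace (factors _ _ _) with (upair (opair a b) (opair a b)).
    + rewrite fsum_sing; rewrite ?pr1_opair, ?pr2_opair, ?term_eq; auto. definable.
    + apply set_ext; intros p; rewrite in_upair, in_factors. split.
      * intros H; assert (p = opair a b) as -> by tauto. exists a, b.
        rewrite in_upair, in_insert; auto.
      * intros (a' & b' & Ha' & Hb' & E & ->). left.
        assert (a' = a) as -> by (apply in_upair in Ha'; tauto).
        apply mono_mul_cancel in E; auto; [congruence|].
        apply in_insert in Hb'; destruct Hb' as [Hb'| ->]; [apply (supp_mono Hb') | exact Hb].
  - intros m Hm; apply in_insert in Hm; destruct Hm as [Hm| ->]; [apply (supp_mono Hm) | exact Hb].
  - intros m Hm; apply in_insert; auto.
Qed.

Lemma term_mul_app_0 c a g m : c ∈ C -> a ∈ Mon -> g ∈ P -> m ∈ Mon ->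
  (forall b, b ∈ Mon -> m <> mono_mul X a b) ->
  app (poly_mul R X (term c a) g) m = zero R.
Proof.
  intros Hc Ha Hg Hm N. rewrite poly_mul_coef by auto. unfold conv.
  replace (factors _ _ _) with (@empty M); [apply fsum_empty; auto; definable|].
  symmetry; apply eq_empty; intros p Hp; apply in_factors in Hp.
  destruct Hp as (a' & b & Ha' & Hb & E & _). apply (N b (supp_mono Hb)).
  rewrite <- E. f_equal. apply in_supp in Ha'; destruct Ha' as [Ma Ha'].
  apply NNPP; intros N'; apply Ha', term_neq; auto.
Qed.

Lemma term_mul_term c a d b : c ∈ C -> a ∈ Mon -> d ∈ C -> b ∈ Mon ->
  poly_mul R X (term c a) (term d b) = term (c * d) (mono_mul X a b).
Proof.
  intros Hc Ha Hd Hb; apply poly_ext; [auto|auto|]. intros m Hm.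
  destruct (classic (exists b', b' ∈ Mon /\ m = mono_mul X a b')) as [(b' & Hb' & ->)|N].
  - rewrite term_mul_app by auto.
    destruct (classic (b' = b)) as [->|Nb].
    + rewrite !term_eq; auto.
    + rewrite !term_neq; auto; [apply (rmul_0_r HR); auto|].
      intros E; apply Nb; apply mono_mul_cancel in E; auto.
  - rewrite term_mul_app_0, term_neq; eauto.
Qed.

(** Reduces additive identities to single terms; associativity can then be proved without reordering
    triple sums. *)
Lemma poly_ind (Q : M -> Prop) : Dprop (fun v => Q (v 0)) ->
  Q (poly_const R X (zero R)) ->
  (forall f c a, f ∈ P -> c ∈ C -> a ∈ Mon -> Q f -> Q (poly_add R X f (term c a))) ->
  forall f, f ∈ P -> Q f.
Proof.
  intros DQ Q0 QS.
  assert (H : forall K, finite K -> forall f, f ∈ P -> sub (supp R X f) K -> Q f).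
  { apply (@finite_ind M (fun K => forall f, f ∈ P -> sub (supp R X f) K -> Q f)); [definable| |].
    - intros f Hf H. replace f with (poly_const R X (zero R)); [exact Q0|].
      change (poly_const R X (zero R)) with (term (zero R) (mono_one X)).
      apply poly_ext; [auto|auto|]. intros m Hm. rewrite (@coef_0 f).
      + destruct (classic (m = mono_one X)) as [->|N]; [apply term_eq | apply term_neq]; auto.
      + exact Hm.
      + intros Hm'; exact (in_empty (H m Hm')).
    - intros K x _ Hx IH f Hf H.
      destruct (classic (x ∈ supp R X f)) as [Sx|Sx].
      + pose proof (supp_mono Sx) as Mx.
        (* The coefficient at x is set to zero, which takes x out of the support; the term at x
           restores [f]. *)
        destruct (@poly_intro (fun m => ite (m = x) (zero R) (app f m)) (supp R X f)) as [G1 G2].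
        * unfold ite; definable.
        * intros m Hm; destruct (classic (m = x)); [rewrite ite_true | rewrite ite_false]; auto.
        * auto.
        * intros m Hm N. apply in_supp; split; [exact Hm|]. intros E; apply N.
          destruct (classic (m = x)); [rewrite ite_true | rewrite ite_false]; auto.
        * set (g := lam Mon _) in *.
          replace f with (poly_add R X g (term (app f x) x)).
          -- apply QS; auto. apply IH; auto. intros m Hm; apply in_supp in Hm.
             destruct Hm as [Mm Hm]. rewrite G2 in Hm by exact Mm.
             assert (Nx : m <> x) by (intros E; apply Hm, ite_true, E).
             rewrite ite_false in Hm by exact Nx.
             assert (m ∈ insert K x) as I by (apply H, in_supp; auto).
             apply in_insert in I; tauto.
          -- apply poly_ext; [auto|auto|]. intros m Hm. rewrite poly_add_app, G2 by auto.
             destruct (classic (m = x)) as [->|N].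
             ++ rewrite ite_true, term_eq, (cr_add0 HR); auto.
             ++ rewrite ite_false, term_neq, (radd_0_r HR); auto.
      + apply IH; [exact Hf|]. intros m Hm. pose proof (H m Hm) as I.
        apply in_insert in I; destruct I as [|E]; [assumption | congruence]. }
  intros f Hf; apply (H (supp R X f)); auto. intros m Hm; exact Hm.
Qed.

Local Notation p0 := (poly_const R X (zero R)).
Local Notation p1 := (poly_const R X (one R)).

Lemma const_in c : c ∈ C -> poly_const R X c ∈ P.
Proof. exact (@term_in c (mono_one X)). Qed.

Hint Resolve const_in : core.

Lemma const_0_app m : m ∈ Mon -> app p0 m = zero R.
Proof.
  intros Hm; change p0 with (term (zero R) (mono_one X)).
  destruct (classic (m = mono_one X)) as [->|N]; [apply term_eq | apply term_neq]; auto.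
Qed.

Lemma poly_add_comm f g : f ∈ P -> g ∈ P -> poly_add R X f g = poly_add R X g f.
Proof.
  intros Hf Hg; apply poly_ext; [auto|auto|]. intros m Hm.
  rewrite !poly_add_app by auto. apply (cr_addC HR); auto.
Qed.

Lemma poly_add_assoc f g h : f ∈ P -> g ∈ P -> h ∈ P ->
  poly_add R X f (poly_add R X g h) = poly_add R X (poly_add R X f g) h.
Proof.
  intros Hf Hg Hh; apply poly_ext; [auto|auto|]. intros m Hm.
  rewrite !poly_add_app by auto. apply (cr_addA HR); auto.
Qed.

Lemma poly_add_0 f : f ∈ P -> poly_add R X p0 f = f.
Proof.
  intros Hf; apply poly_ext; [auto|auto|]. intros m Hm.
  rewrite poly_add_app, const_0_app by auto. apply (cr_add0 HR); auto.
Qed.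

Lemma poly_opp f : f ∈ P -> exists g, g ∈ P /\ poly_add R X f g = p0.
Proof.
  (* Negatives in R are unique, so a description yields the coefficientwise negative as a definable
     function. *)
  intros Hf. pose (F := fun m => the (fun y => y ∈ C /\ app f m + y = zero R)).
  assert (HF : forall m, m ∈ Mon -> F m ∈ C /\ app f m + F m = zero R).
  { intros m Hm. apply (@the_spec M (fun y => y ∈ C /\ app f m + y = zero R)).
    destruct (cr_opp HR (app f m)) as (y & Hy & E); [auto|].
    exists y; split; [auto|]. intros z [Hz E'].
    apply (@radd_cancel M R HR _ _ (app f m)); auto.
    rewrite !(cr_addC HR _ (app f m)) by auto. congruence. }
  destruct (@poly_intro F (supp R X f)) as [G1 G2].
  - unfold F; definable.
  - apply HF.
  - auto.
  - intros m Hm N. apply in_supp; split; [exact Hm|]. intros E. destruct (HF m Hm) as [H1 H2].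
    rewrite E, (cr_add0 HR) in H2; auto.
  - exists (lam Mon F); split; [exact G1|]. apply poly_ext; [auto|auto|]. intros m Hm.
    rewrite poly_add_app, G2, const_0_app by auto. apply HF, Hm.
Qed.

Lemma poly_mul_add_l f g h : f ∈ P -> g ∈ P -> h ∈ P ->
  poly_mul R X (poly_add R X f g) h = poly_add R X (poly_mul R X f h) (poly_mul R X g h).
Proof.
  intros Hf Hg Hh.
  rewrite poly_mul_comm, poly_mul_add, (@poly_mul_comm h f), (@poly_mul_comm h g) by auto.
  reflexivity.
Qed.

Lemma const_mul_app c f m : c ∈ C -> f ∈ P -> m ∈ Mon ->
  app (poly_mul R X (poly_const R X c) f) m = c * app f m.
Proof.
  intros Hc Hf Hm. rewrite <- (mono_mul_1 Hm) at 1.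
  exact (@term_mul_app c (mono_one X) f m Hc mono_one_in Hf Hm).
Qed.

Lemma poly_mul_1 f : f ∈ P -> poly_mul R X p1 f = f.
Proof.
  intros Hf; apply poly_ext; [auto|auto|]. intros m Hm.
  rewrite const_mul_app by auto. apply (cr_mul1 HR); auto.
Qed.

Lemma poly_mul_0 f : f ∈ P -> poly_mul R X p0 f = p0.
Proof.
  intros Hf; apply poly_ext; [auto|auto|]. intros m Hm.
  rewrite const_mul_app, const_0_app by auto. apply (rmul_0_l HR); auto.
Qed.

Lemma poly_mul_0_r f : f ∈ P -> poly_mul R X f p0 = p0.
Proof. intros Hf; rewrite poly_mul_comm, poly_mul_0; auto. Qed.

(** Associativity is extended from terms to polynomials one argument at a time: here the third, then
    the second, then the first, each time by distributivity. *)
Lemma term_term_assoc c a d b h : c ∈ C -> a ∈ Mon -> d ∈ C -> b ∈ Mon -> h ∈ P ->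
  poly_mul R X (term c a) (poly_mul R X (term d b) h) =
  poly_mul R X (poly_mul R X (term c a) (term d b)) h.
Proof.
  intros Hc Ha Hd Hb; revert h. apply (@poly_ind (fun h =>
    poly_mul R X (term c a) (poly_mul R X (term d b) h) =
    poly_mul R X (poly_mul R X (term c a) (term d b)) h)).
  - definable.
  - rewrite !poly_mul_0_r; auto.
  - intros h e k Hh He Hk IH. rewrite !poly_mul_add by auto. rewrite IH by auto.
    rewrite !term_mul_term by auto. rewrite mono_mul_assoc, (cr_mulA HR) by auto. reflexivity.
Qed.

Lemma term_assoc c a g h : c ∈ C -> a ∈ Mon -> g ∈ P -> h ∈ P ->
  poly_mul R X (term c a) (poly_mul R X g h) = poly_mul R X (poly_mul R X (term c a) g) h.
Proof.
  intros Hc Ha Hg Hh; revert g Hg. apply (@poly_ind (fun g =>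
    poly_mul R X (term c a) (poly_mul R X g h) = poly_mul R X (poly_mul R X (term c a) g) h)).
  - definable.
  - rewrite poly_mul_0, !poly_mul_0_r, poly_mul_0; auto.
  - intros g d b Hg Hd Hb IH. rewrite poly_mul_add_l, !poly_mul_add, poly_mul_add_l by auto.
    rewrite IH, term_term_assoc by auto. reflexivity.
Qed.

Lemma poly_mul_assoc f g h : f ∈ P -> g ∈ P -> h ∈ P ->
  poly_mul R X f (poly_mul R X g h) = poly_mul R X (poly_mul R X f g) h.
Proof.
  intros Hf Hg Hh; revert f Hf. apply (@poly_ind (fun f =>
    poly_mul R X f (poly_mul R X g h) = poly_mul R X (poly_mul R X f g) h)).
  - definable.
  - rewrite !poly_mul_0; auto.
  - intros f c a Hf Hc Ha IH. rewrite !poly_mul_add_l by auto.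
    rewrite IH, term_assoc by auto. reflexivity.
Qed.

Lemma poly_radd f g : f ∈ P -> g ∈ P -> radd (poly_ring R X) f g = poly_add R X f g.
Proof.
  intros Hf Hg. refine (@app2_lam2 M (poly_add R X) _ P _ f g Hf Hg); [definable | auto].
Qed.

Lemma poly_rmul f g : f ∈ P -> g ∈ P -> rmul (poly_ring R X) f g = poly_mul R X f g.
Proof.
  intros Hf Hg. refine (@app2_lam2 M (poly_mul R X) _ P _ f g Hf Hg); [definable | auto].
Qed.

Lemma poly_comm_ring : is_comm_ring (poly_ring R X).
Proof.
  constructor; cbn [car addf mulf zero one poly_ring].
  - apply lam2_fun; [definable | auto].
  - apply lam2_fun; [definable | auto].
  - auto.
  - auto.
  - intros; rewrite !poly_radd by (rewrite ?poly_radd by auto; auto). apply poly_add_assoc; auto.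
  - intros; rewrite !poly_radd by auto. apply poly_add_comm; auto.
  - intros; rewrite poly_radd by auto. apply poly_add_0; auto.
  - intros f Hf. destruct (poly_opp Hf) as (g & Hg & E). exists g; rewrite poly_radd; auto.
  - intros; rewrite !poly_rmul by (rewrite ?poly_rmul by auto; auto). apply poly_mul_assoc; auto.
  - intros; rewrite !poly_rmul by auto. apply poly_mul_comm; auto.
  - intros; rewrite poly_rmul by auto. apply poly_mul_1; auto.
  - intros f g h Hf Hg Hh. rewrite !poly_rmul by (rewrite ?poly_radd by auto; auto).
    rewrite !poly_radd by auto. apply poly_mul_add; auto.
Qed.
End Polynomials.

#[export] Hint Resolve coef_in supp_finite poly_add_in term_in poly_mul_in const_in : core.

(** * Ideals generated by variables *)

Section UniqueProduct.
Context {M : ZF_model} {X : M}.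
Local Notation Mon := (monomials X).
Implicit Types a b x m A B V : M.

(** Induction on [V]: passing to the elements of maximal exponent in [x] removes
    [x] from the variables in which [A] and [B] may vary. *)
Lemma unique_product V : finite V -> forall A B, sub A Mon -> sub B Mon ->
  finite A -> finite B -> (exists a, a ∈ A) -> (exists b, b ∈ B) ->
  (forall a a' x, a ∈ A -> a' ∈ A -> x ∈ X -> ~ x ∈ V -> app a x = app a' x) ->
  (forall b b' x, b ∈ B -> b' ∈ B -> x ∈ X -> ~ x ∈ V -> app b x = app b' x) ->
  exists a0 b0, a0 ∈ A /\ b0 ∈ B /\ forall a b, a ∈ A -> b ∈ B ->
    mono_mul X a b = mono_mul X a0 b0 -> a = a0 /\ b = b0.
Proof.
  revert V. apply (@finite_ind M (fun V => forall A B, sub A Mon -> sub B Mon ->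
    finite A -> finite B -> (exists a, a ∈ A) -> (exists b, b ∈ B) ->
    (forall a a' x, a ∈ A -> a' ∈ A -> x ∈ X -> ~ x ∈ V -> app a x = app a' x) ->
    (forall b b' x, b ∈ B -> b' ∈ B -> x ∈ X -> ~ x ∈ V -> app b x = app b' x) ->
    exists a0 b0, a0 ∈ A /\ b0 ∈ B /\ forall a b, a ∈ A -> b ∈ B ->
      mono_mul X a b = mono_mul X a0 b0 -> a = a0 /\ b = b0)); [definable| |].
  - intros A B AM BM _ _ [a0 Ha0] [b0 Hb0] EA EB. exists a0, b0; do 2 (split; [assumption|]).
    intros a b Ha Hb _; split; (apply (@mono_ext M X); [auto|auto|]); intros x Hx;
      [apply EA | apply EB]; auto; apply in_empty.
  - intros V x _ _ IH A B AM BM FA FB NA NB EA EB.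
    destruct (classic (x ∈ X)) as [Hx|Hx].
    (* If x is not in X, the conditions on exponents never mention it, so [V] may replace
       [insert V x]. *)
    2: { apply IH; auto; [intros a a' y Ha Ha' Hy N; apply EA | intros a a' y Ha Ha' Hy N; apply EB];
         auto; rewrite in_insert; intros [|E]; auto; subst; auto. }
    assert (top : forall A, sub A Mon -> finite A -> (exists a, a ∈ A) ->
      (forall a a' y, a ∈ A -> a' ∈ A -> y ∈ X -> ~ y ∈ insert V x -> app a y = app a' y) ->
      exists A', sub A' A /\ (exists a, a ∈ A') /\
        (forall a a' y, a ∈ A' -> a' ∈ A' -> y ∈ X -> ~ y ∈ V -> app a y = app a' y) /\
        (forall a a', a ∈ A -> a' ∈ A' -> exists k, k ∈ omega /\ app a' x = plus (app a x) k) /\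
        (forall a a', a ∈ A -> a' ∈ A' -> app a x = app a' x -> a ∈ A')).
    { clear - Hx. intros A AM FA NA EA.
      destruct (@finite_max M (fun a => app a x) A) as (c & Hc & K);
        [definable | exact FA | intros a Ha; apply (mono_app (AM a Ha) Hx) | exact NA |].
      assert (H : forall a, a ∈ setof (fun a => a ∈ A /\ app a x = app c x) <->
        a ∈ A /\ app a x = app c x).
      { apply in_sep with (a := A); [definable | tauto]. }
      exists (setof (fun a => a ∈ A /\ app a x = app c x)).
      split; [intros a Ha; apply H in Ha; tauto|]. split; [exists c; apply H; auto|].
      split; [|split].
      - intros a a' y Ha Ha' Hy N. apply H in Ha; apply H in Ha'.
        destruct (classic (y = x)) as [->|Ny]; [destruct Ha, Ha'; congruence|].
        apply EA; try tauto. rewrite in_insert; tauto.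
      - intros a a' Ha Ha'; apply H in Ha'; destruct Ha' as [_ ->]; auto.
      - intros a a' Ha Ha' E. apply H; split; [exact Ha|]. apply H in Ha'; destruct Ha'; congruence. }
    destruct (top A AM FA NA EA) as (A' & AS & NA' & EA' & MA & UA).
    destruct (top B BM FB NB EB) as (B' & BS & NB' & EB' & MB & UB).
    unfold sub in AM, BM, AS, BS.
    destruct (IH A' B') as (a0 & b0 & Ha0 & Hb0 & U); auto.
    { intros a Ha; auto. }
    { intros b Hb; auto. }
    { apply finite_sub with (B := A); assumption. }
    { apply finite_sub with (B := B); assumption. }
    exists a0, b0; do 2 (split; [auto|]). intros a b Ha Hb E.
    destruct (MA a a0 Ha Ha0) as (k & Hk & Ek). destruct (MB b b0 Hb Hb0) as (l & Hl & El).
    pose proof (mono_app (AM a Ha) Hx) as Wa. pose proof (mono_app (BM b Hb) Hx) as Wb.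
    (* The two equal products have the same exponent in x, so both deficits [k] and [l] vanish;
       hence a and b have maximal exponent themselves and lie in [A'] and [B']. *)
    assert (E' : plus (plus (app a x) (app b x)) empty =
                 plus (plus (app a x) (app b x)) (plus k l)).
    { rewrite plus_0 by auto.
      transitivity (app (mono_mul X a b) x); [symmetry; apply mono_mul_app; auto|].
      rewrite E, mono_mul_app, Ek, El by auto.
      rewrite <- !plus_assoc by auto. f_equal.
      rewrite !plus_assoc by auto. rewrite (@plus_comm M k) by auto. reflexivity. }
    apply plus_cancel_l in E'; auto. symmetry in E'; apply plus_eq_0 in E'; auto.
    destruct E' as [-> ->]. rewrite plus_0 in Ek, El by auto.
    apply U; [apply (UA a a0) | apply (UB b b0) |]; auto.
Qed.
End UniqueProduct.

(** * Primality of the ideals generated by variables *)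

Section MonomialIdeals.
Context {M : ZF_model} {R : ring M} (HD : is_domain R) {X : M}.
Let HR : is_comm_ring R := dom_comm_ring HD.
Local Notation Mon := (monomials X).
Local Notation P := (polys R X).
Implicit Types a b f g m T : M.

(** [in_ideal T f]: [f] lies in the ideal generated by the variables in [T]. *)
Definition hits T m : Prop := exists t, t ∈ T /\ t ∈ X /\ app m t <> empty.
Definition in_ideal T f : Prop := forall m, m ∈ supp R X f -> hits T m.

Lemma hits_mul T a b : a ∈ Mon -> b ∈ Mon ->
  hits T (mono_mul X a b) <-> hits T a \/ hits T b.
Proof.
  intros Ha Hb; split.
  - intros (t & Ht & Hx & N). rewrite mono_mul_app in N by auto.
    destruct (classic (app a t = empty)) as [E|E]; [|left; exists t; auto].
    destruct (classic (app b t = empty)) as [E'|E']; [|right; exists t; auto].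
    destruct N; rewrite E, E', plus_0; auto.
  - intros [(t & Ht & Hx & N)|(t & Ht & Hx & N)]; exists t; (do 2 (split; [assumption|]));
      rewrite mono_mul_app by auto; intros E;
      destruct (plus_eq_0 (mono_app Ha Hx) (mono_app Hb Hx) E); tauto.
Qed.

Lemma in_ideal_add T f g : f ∈ P -> g ∈ P ->
  in_ideal T f -> in_ideal T g -> in_ideal T (poly_add R X f g).
Proof.
  intros Hf Hg If Ig m Hm. apply in_supp in Hm; destruct Hm as [Mm N].
  apply NNPP; intros Nh. apply N. rewrite (poly_add_app HR) by auto.
  rewrite (@coef_0 M R X f), (@coef_0 M R X g); auto.
  - apply (cr_add0 HR); auto.
Qed.

Lemma in_ideal_mul T f g : f ∈ P -> g ∈ P -> in_ideal T g -> in_ideal T (poly_mul R X f g).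
Proof.
  intros Hf Hg Ig m Hm. apply in_supp in Hm; destruct Hm as [Mm N].
  apply NNPP; intros Nh. apply N. rewrite (poly_mul_coef HR) by auto. unfold conv.
  replace (factors _ _ _) with (@empty M); [apply (fsum_empty HR); definable|].
  symmetry; apply eq_empty; intros p Hp; apply in_factors in Hp.
  destruct Hp as (a & b & Ha & Hb & E & _). apply Nh. rewrite <- E.
  apply hits_mul; [apply (supp_mono Ha) | apply (supp_mono Hb) |]. right; apply Ig, Hb.
Qed.

(** Otherwise the monomials of f and of g that avoid T form nonempty finite sets [A] and [B], with a
    unique product [a0 b0]. Any factorization of [a0 b0] into monomials of f and g avoids T, hence
    lies in [A] and [B]. So the coefficient of f g at [a0 b0] is a product of two nonzero elements
    of a domain, although [a0 b0] avoids T. *)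
Lemma in_ideal_prime T f g : f ∈ P -> g ∈ P ->
  in_ideal T (poly_mul R X f g) -> in_ideal T f \/ in_ideal T g.
Proof.
  intros Hf Hg I. apply NNPP; intros N.
  assert (avoid : forall f, ~ in_ideal T f -> exists m, m ∈ supp R X f /\ ~ hits T m).
  { intros h Nh. apply NNPP; intros K; apply Nh; intros m Hm.
    apply NNPP; intros K'; apply K; eauto. }
  assert (Hs : forall f a, a ∈ setof (fun a => a ∈ supp R X f /\ ~ hits T a) <->
    a ∈ supp R X f /\ ~ hits T a).
  { intros h; apply in_sep with (a := supp R X h); [unfold hits; definable | tauto]. }
  set (A := setof (fun a => a ∈ supp R X f /\ ~ hits T a)).
  set (B := setof (fun a => a ∈ supp R X g /\ ~ hits T a)).
  assert (HA : forall a, a ∈ A <-> a ∈ supp R X f /\ ~ hits T a) by apply Hs.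
  assert (HB : forall a, a ∈ B <-> a ∈ supp R X g /\ ~ hits T a) by apply Hs.
  clearbody A B. clear Hs.
  assert (AM : sub A Mon) by (intros a Ha; apply HA in Ha; apply (supp_mono (proj1 Ha))).
  assert (BM : sub B Mon) by (intros a Ha; apply HB in Ha; apply (supp_mono (proj1 Ha))).
  unfold sub in AM, BM.
  assert (FA : finite A).
  { apply finite_sub with (B := supp R X f); [auto|]. intros a Ha; apply HA in Ha; tauto. }
  assert (FB : finite B).
  { apply finite_sub with (B := supp R X g); [auto|]. intros a Ha; apply HB in Ha; tauto. }
  (* Outside the variables that occur in [A] or [B] all exponents are zero, so the hypotheses of
     [unique_product] hold for this [V]. *)
  destruct (@finite_bigcup M (fun m => vars X m) (cup A B)) as (V & FV & HV).
  { unfold vars; definable. }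
  { apply finite_cup; assumption. }
  { intros m Hm; apply in_cup in Hm.
    assert (Mm : m ∈ Mon) by (destruct Hm; auto). apply in_monomials in Mm; tauto. }
  destruct (@unique_product M X V FV A B AM BM FA FB) as (a0 & b0 & Ha0 & Hb0 & U).
  { destruct (avoid f) as (a & Ha); [tauto|]. exists a; apply HA, Ha. }
  { destruct (avoid g) as (b & Hb); [tauto|]. exists b; apply HB, Hb. }
  { assert (Z : forall a x, a ∈ A -> x ∈ X -> ~ x ∈ V -> app a x = empty).
    { intros a x Ha Hx Nx. apply NNPP; intros Na. apply Nx, HV. exists a.
      rewrite in_cup, in_vars; auto. }
    intros a a' x Ha Ha' Hx Nx. rewrite !Z; auto. }
  { assert (Z : forall a x, a ∈ B -> x ∈ X -> ~ x ∈ V -> app a x = empty).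
    { intros a x Ha Hx Nx. apply NNPP; intros Na. apply Nx, HV. exists a.
      rewrite in_cup, in_vars; auto. }
    intros a a' x Ha Ha' Hx Nx. rewrite !Z; auto. }
  pose proof (proj1 (HA a0) Ha0) as [Sa Na]. pose proof (proj1 (HB b0) Hb0) as [Sb Nb].
  pose proof (supp_mono Sa) as Ma. pose proof (supp_mono Sb) as Mb.
  assert (Nm : ~ hits T (mono_mul X a0 b0)) by (rewrite hits_mul by assumption; tauto).
  apply Nm, I, in_supp; split; [auto|].
  rewrite (poly_mul_coef HR) by auto. unfold conv.
  replace (factors _ _ _) with (upair (opair a0 b0) (opair a0 b0)).
  - apply in_supp in Sa; apply in_supp in Sb.
    pose proof (coef_in Hf Ma) as Ca. pose proof (coef_in Hg Mb) as Cb.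
    rewrite (fsum_sing HR); [|definable|]; rewrite pr1_opair, pr2_opair; [|auto].
    intros E; apply (dom_no_zero_div HD) in E; tauto.
  - apply set_ext; intros p; rewrite in_upair, in_factors; split.
    + intros H. exists a0, b0; tauto.
    + intros (a & b & Ha & Hb & E & ->). left.
      rewrite <- E, hits_mul in Nm by (eapply supp_mono; eassumption).
      destruct (U a b) as [-> ->]; [apply HA; tauto | apply HB; tauto | exact E | reflexivity].
Qed.
End MonomialIdeals.

(** * Localization *)

Section Elements.
Context {M : ZF_model} {A : ring M} (HA : is_comm_ring A).

(** The elements of [A] as a type, so that the [ring] tactic applies. *)
Definition elt : Type := {x : M | x ∈ car A}.
Definition mk x (H : x ∈ car A) : elt := exist _ x H.
Definition eadd (x y : elt) : elt :=
  mk (radd_in HA (proj2_sig x) (proj2_sig y)).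
Definition emul (x y : elt) : elt :=
  mk (rmul_in HA (proj2_sig x) (proj2_sig y)).
Definition ezero : elt := mk (rzero_in HA).
Definition eone : elt := mk (rone_in HA).

Lemma elt_eq (x y : elt) : proj1_sig x = proj1_sig y -> x = y.
Proof.
  destruct x as [x Hx], y as [y Hy]; simpl; intros E; subst y.
  f_equal; apply proof_irrelevance.
Qed.

Lemma val_mk x (H : x ∈ car A) : proj1_sig (mk H) = x.
Proof. reflexivity. Qed.

Lemma val_add x y : proj1_sig (eadd x y) = radd A (proj1_sig x) (proj1_sig y).
Proof. reflexivity. Qed.

Lemma val_mul x y : proj1_sig (emul x y) = rmul A (proj1_sig x) (proj1_sig y).
Proof. reflexivity. Qed.

(** The identities for fractions involve no subtraction. A semiring structure suffices, and no
    negation has to be extracted from the bare existence of opposites. *)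
Lemma elt_ring : semi_ring_theory ezero eone eadd emul eq.
Proof.
  constructor; intros; apply elt_eq; repeat match goal with x : elt |- _ => destruct x end;
    cbn [proj1_sig eadd emul ezero eone].
  - apply (cr_add0 HA); auto.
  - apply (cr_addC HA); auto.
  - apply (cr_addA HA); auto.
  - apply (cr_mul1 HA); auto.
  - apply (rmul_0_l HA); auto.
  - apply (cr_mulC HA); auto.
  - apply (cr_mulA HA); auto.
  - apply (rdistr_l HA); auto.
Qed.

Add Ring elt_semi_ring : elt_ring.

Local Infix "+" := eadd.
Local Infix "*" := emul.

(** Transitivity of equality of fractions: the first equation is multiplied by [v * w], the second
    by [u * s], and [t] joins the multiplier. *)
Lemma elt_frac_trans a s b t c w u v :
  u * (a * t) = u * (b * s) -> v * (b * w) = v * (c * t) ->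
  (u * v * t) * (a * w) = (u * v * t) * (c * s).
Proof.
  intros E1 E2. transitivity (v * w * (u * (a * t))); [ring|]. rewrite E1.
  transitivity (u * s * (v * (b * w))); [ring|]. rewrite E2. ring.
Qed.

Lemma elt_frac_add a s b t a' s' b' t' u v :
  u * (a * s') = u * (a' * s) -> v * (b * t') = v * (b' * t) ->
  (u * v) * ((a * t + b * s) * (s' * t')) = (u * v) * ((a' * t' + b' * s') * (s * t)).
Proof.
  intros E1 E2.
  transitivity (v * t * t' * (u * (a * s')) + u * s * s' * (v * (b * t'))); [ring|].
  rewrite E1, E2. ring.
Qed.

Lemma elt_frac_mul a s b t a' s' b' t' u v :
  u * (a * s') = u * (a' * s) -> v * (b * t') = v * (b' * t) ->
  (u * v) * ((a * b) * (s' * t')) = (u * v) * ((a' * b') * (s * t)).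
Proof.
  intros E1 E2. transitivity ((u * (a * s')) * (v * (b * t'))); [ring|].
  rewrite E1, E2. ring.
Qed.
End Elements.

(** Brings an implication between equations in [elt] back to the carrier: the premises are reduced
    to equations of underlying elements, and the conclusion is projected. *)
Ltac elt_calc H :=
  let K := fresh in
  pose proof H as K;
  lapply K; [clear K; intros K; lapply K|];
  [ clear K; intros K; apply (f_equal (@proj1_sig _ _)) in K;
    rewrite ?val_mul, ?val_add, ?val_mul, ?val_mk in K; exact K
  | apply elt_eq; rewrite ?val_mul, ?val_mk; assumption .. ].

(** * Arithmetic of fractions and contraction of a maximal ideal *)

Section Localization.
Context {M : ZF_model} {A : ring M} (HA : is_comm_ring A) {S : M} (HS : is_mult_subset A S).
Local Notation C := (car A).
Local Infix "+" := (radd A).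
Local Infix "*" := (rmul A).
Local Notation L := (localization A S).
Local Notation fr := (frac A S).
Implicit Types a b c f g s t u v w x p : M.

Lemma ms_in s : s ∈ S -> s ∈ C.
Proof. apply (ms_sub HS). Qed.

Lemma ms_1 : one A ∈ S.
Proof. exact (ms_one HS). Qed.

Lemma ms_mult s t : s ∈ S -> t ∈ S -> s * t ∈ S.
Proof. apply (ms_mul HS). Qed.

Hint Resolve ms_in ms_1 ms_mult : core.

Lemma in_frac a s p : p ∈ fr a s <-> exists b t u,
  b ∈ C /\ t ∈ S /\ u ∈ S /\ p = opair b t /\ u * (a * t) = u * (b * s).
Proof.
  unfold frac; apply in_sep with (a := cprod C S); [definable|].
  intros q (b & t & _ & Hb & Ht & _ & -> & _); apply opair_in_cprod; auto.
Qed.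

(** A fraction contains its own representative, with multiplier 1. Conversely, transitivity gives
    one inclusion of classes ([half]) and symmetry the other. *)
Lemma frac_eq a s b t : a ∈ C -> s ∈ S -> b ∈ C -> t ∈ S ->
  fr a s = fr b t <-> exists u, u ∈ S /\ u * (a * t) = u * (b * s).
Proof.
  assert (half : forall a s b t u, a ∈ C -> s ∈ S -> b ∈ C -> t ∈ S -> u ∈ S ->
    u * (a * t) = u * (b * s) -> forall p, p ∈ fr b t -> p ∈ fr a s).
  { intros a' s' b' t' u Ha Hs Hb Ht Hu E p Hp. apply in_frac in Hp.
    destruct Hp as (c & w & v & Hc & Hw & Hv & -> & E').
    apply in_frac; exists c, w, (u * v * t'); do 2 (split; [assumption|]).
    split; [auto|]. split; [reflexivity|].
    elt_calc (@elt_frac_trans M A HA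
      (mk Ha) (mk (ms_in Hs)) (mk Hb) (mk (ms_in Ht))
      (mk Hc) (mk (ms_in Hw)) (mk (ms_in Hu)) (mk (ms_in Hv))). }
  intros Ha Hs Hb Ht; split.
  - intros E. assert (H : opair b t ∈ fr a s).
    { rewrite E. apply in_frac; exists b, t, (one A); auto 10. }
    apply in_frac in H. destruct H as (b' & t' & u & _ & _ & Hu & Ep & E').
    apply opair_inj in Ep; destruct Ep; subst b' t'; eauto.
  - intros (u & Hu & E). apply set_ext; intros p; split; eapply half; eauto.
Qed.

Lemma in_fracs c : c ∈ fracs A S <-> exists a s, a ∈ C /\ s ∈ S /\ c = fr a s.
Proof.
  unfold fracs; apply in_sep with (a := pow (cprod C S)); [unfold frac; definable|].
  intros x (a & s & Ha & Hs & ->). apply in_pow; intros p Hp; apply in_frac in Hp.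
  destruct Hp as (b & t & _ & Hb & Ht & _ & -> & _); apply opair_in_cprod; auto.
Qed.

Lemma frac_in a s : a ∈ C -> s ∈ S -> fr a s ∈ fracs A S.
Proof. intros; apply in_fracs; eauto. Qed.

Hint Resolve frac_in : core.

Lemma frac_ext a s b t : a ∈ C -> s ∈ S -> b ∈ C -> t ∈ S -> a * t = b * s -> fr a s = fr b t.
Proof. intros Ha Hs Hb Ht E; apply frac_eq; [auto..|]. exists (one A); split; [auto | congruence]. Qed.

(** [addf] of the localization runs over all representatives, so its value is known only once it is
    independent of them, which [elt_frac_add] provides. *)
Lemma frac_add a s b t : a ∈ C -> s ∈ S -> b ∈ C -> t ∈ S ->
  radd L (fr a s) (fr b t) = fr (a * t + b * s) (s * t).
Proof.
  intros Ha Hs Hb Ht.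
  assert (HL : forall p, p ∈ addf L <-> exists a s b t, a ∈ C /\ s ∈ S /\ b ∈ C /\ t ∈ S /\
    p = opair (opair (fr a s) (fr b t)) (fr (a * t + b * s) (s * t))).
  { cbn [addf localization].
    apply in_sep with (a := cprod (cprod (fracs A S) (fracs A S)) (fracs A S));
      [unfold frac; definable|].
    intros p (a' & s' & b' & t' & H1 & H2 & H3 & H4 & ->). rewrite !opair_in_cprod; auto 10. }
  unfold radd at 1; unfold app2, app. apply the_eq; [apply HL; exists a, s, b, t; auto|].
  intros z Hz; apply HL in Hz. destruct Hz as (a' & s' & b' & t' & H1 & H2 & H3 & H4 & E).
  apply opair_inj in E; destruct E as [E ->]; apply opair_inj in E; destruct E as [E1 E2].
  apply (frac_eq Ha Hs H1 H2) in E1. apply (frac_eq Hb Ht H3 H4) in E2.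
  destruct E1 as (u & Hu & E1), E2 as (v & Hv & E2).
  symmetry. apply frac_eq; [auto..|]. exists (u * v); split; [auto|].
  elt_calc (@elt_frac_add M A HA
      (mk Ha) (mk (ms_in Hs)) (mk Hb) (mk (ms_in Ht))
      (mk H1) (mk (ms_in H2)) (mk H3) (mk (ms_in H4))
      (mk (ms_in Hu)) (mk (ms_in Hv))).
Qed.

Lemma frac_mul a s b t : a ∈ C -> s ∈ S -> b ∈ C -> t ∈ S ->
  rmul L (fr a s) (fr b t) = fr (a * b) (s * t).
Proof.
  intros Ha Hs Hb Ht.
  assert (HL : forall p, p ∈ mulf L <-> exists a s b t, a ∈ C /\ s ∈ S /\ b ∈ C /\ t ∈ S /\
    p = opair (opair (fr a s) (fr b t)) (fr (a * b) (s * t))).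
  { cbn [mulf localization].
    apply in_sep with (a := cprod (cprod (fracs A S) (fracs A S)) (fracs A S));
      [unfold frac; definable|].
    intros p (a' & s' & b' & t' & H1 & H2 & H3 & H4 & ->). rewrite !opair_in_cprod; auto 10. }
  unfold rmul at 1; unfold app2, app. apply the_eq; [apply HL; exists a, s, b, t; auto|].
  intros z Hz; apply HL in Hz. destruct Hz as (a' & s' & b' & t' & H1 & H2 & H3 & H4 & E).
  apply opair_inj in E; destruct E as [E ->]; apply opair_inj in E; destruct E as [E1 E2].
  apply (frac_eq Ha Hs H1 H2) in E1. apply (frac_eq Hb Ht H3 H4) in E2.
  destruct E1 as (u & Hu & E1), E2 as (v & Hv & E2).
  symmetry. apply frac_eq; [auto..|]. exists (u * v); split; [auto|].
  elt_calc (@elt_frac_mul M A HA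
      (mk Ha) (mk (ms_in Hs)) (mk Hb) (mk (ms_in Ht))
      (mk H1) (mk (ms_in H2)) (mk H3) (mk (ms_in H4))
      (mk (ms_in Hu)) (mk (ms_in Hv))).
Qed.

(** For an ideal [I] this is its extension to the localization. *)
Definition frac_ideal I : M := setof (fun c => exists a s, a ∈ I /\ s ∈ S /\ c = fr a s).

Lemma in_frac_ideal I c : sub I C ->
  c ∈ frac_ideal I <-> exists a s, a ∈ I /\ s ∈ S /\ c = fr a s.
Proof.
  intros HI; unfold frac_ideal; apply in_sep with (a := fracs A S); [unfold frac; definable|].
  intros x (a & s & Ha & Hs & ->); auto.
Qed.

Lemma frac_ideal_ideal I : is_ideal A I -> is_ideal L (frac_ideal I).
Proof.
  intros HI. pose proof (id_sub HI) as IC.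
  split.
  - intros c Hc; apply in_frac_ideal in Hc; [|exact IC]. destruct Hc as (a & s & Ha & Hs & ->).
    apply frac_in; auto.
  - apply in_frac_ideal; [exact IC|]. exists (zero A), (one A). split; [apply (id_zero HI) | auto].
  - intros x y Hx Hy. apply in_frac_ideal in Hx; [|exact IC]. apply in_frac_ideal in Hy; [|exact IC].
    destruct Hx as (a & s & Ha & Hs & ->), Hy as (b & t & Hb & Ht & ->).
    rewrite frac_add by auto. apply in_frac_ideal; [exact IC|].
    exists (a * t + b * s), (s * t); split; [|auto]. apply (id_add HI).
    + rewrite (cr_mulC HA) by auto. apply (id_mul HI); auto.
    + rewrite (cr_mulC HA) by auto. apply (id_mul HI); auto.
  - intros x y Hx Hy. apply in_fracs in Hx. apply in_frac_ideal in Hy; [|exact IC].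
    destruct Hx as (a & s & Ha & Hs & ->), Hy as (b & t & Hb & Ht & ->).
    rewrite frac_mul by auto. apply in_frac_ideal; [exact IC|].
    exists (a * b), (s * t); split; [|auto]. apply (id_mul HI); auto.
Qed.

Lemma proper_ideal J : is_ideal L J -> J <> fracs A S -> ~ fr (one A) (one A) ∈ J.
Proof.
  intros HJ N H; apply N, set_ext; intros c; split; [apply (id_sub HJ)|].
  intros Hc; pose proof (id_mul HJ _ _ Hc H) as K.
  apply in_fracs in Hc; destruct Hc as (a & s & Ha & Hs & ->).
  rewrite frac_mul in K by auto. rewrite !(rmul_1_r HA) in K by auto. exact K.
Qed.

(** The contraction [I] need not be maximal in A, but it is maximal among the ideals disjoint from
    S: for x outside [I], the ideal I + Ax extends to the whole localization and therefore meets
    S. *)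
Lemma maximal_contraction J : is_maximal_ideal L J ->
  exists I, is_ideal A I /\ (forall s, s ∈ S -> ~ s ∈ I) /\
    forall x, x ∈ C -> ~ x ∈ I -> exists f g, f ∈ I /\ g ∈ C /\ f + g * x ∈ S.
Proof.
  intros [HJ JP JM]. pose proof (proper_ideal HJ JP) as J1.
  pose (I := setof (fun a => a ∈ C /\ fr a (one A) ∈ J)).
  assert (inI : forall a, a ∈ I <-> a ∈ C /\ fr a (one A) ∈ J).
  { unfold I; apply in_sep with (a := C); [unfold frac; definable | tauto]. }
  clearbody I.
  assert (HI : is_ideal A I).
  { split.
    - intros a Ha; apply inI in Ha; tauto.
    - apply inI; split; [auto | exact (id_zero HJ)].
    - intros a b Ha Hb; apply inI in Ha, Hb; destruct Ha as [Ha Ja], Hb as [Hb Jb].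
      apply inI; split; [auto|]. pose proof (id_add HJ _ _ Ja Jb) as K.
      rewrite frac_add in K by auto. rewrite !(rmul_1_r HA) in K by auto. exact K.
    - intros c a Hc Ha; apply inI in Ha; destruct Ha as [Ha Ja].
      apply inI; split; [auto|]. pose proof (id_mul HJ _ _ (frac_in Hc ms_1) Ja) as K.
      rewrite frac_mul in K by auto. rewrite !(rmul_1_r HA) in K by auto. exact K. }
  exists I; split; [exact HI|]. split.
  - intros s Hs H; apply inI in H; destruct H as [_ H]. apply J1.
    pose proof (id_mul HJ _ _ (frac_in (rone_in HA) Hs) H) as K.
    rewrite frac_mul in K by auto.
    replace (fr (one A) (one A)) with (fr (one A * s) (s * one A)); [exact K|].
    apply frac_ext; [auto..|]. symmetry; apply (cr_mulA HA); auto.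
  - intros x Hx Nx.
    pose (Ix := setof (fun a => exists f g, f ∈ I /\ g ∈ C /\ a = f + g * x)).
    pose proof (id_sub HI) as IC. unfold sub in IC.
    assert (inIx : forall a, a ∈ Ix <-> exists f g, f ∈ I /\ g ∈ C /\ a = f + g * x).
    { unfold Ix; apply in_sep with (a := C); [definable|].
      intros a (f & g & Hf & Hg & ->); auto. }
    clearbody Ix.
    assert (HIx : is_ideal A Ix).
    { split.
      - intros a Ha; apply inIx in Ha; destruct Ha as (f & g & Hf & Hg & ->); auto.
      - apply inIx; exists (zero A), (zero A). split; [apply (id_zero HI)|]. split; [auto|].
        rewrite (rmul_0_l HA), (cr_add0 HA); auto.
      - intros a b Ha Hb; apply inIx in Ha, Hb.
        destruct Ha as (f & g & Hf & Hg & ->), Hb as (f' & g' & Hf' & Hg' & ->).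
        apply inIx; exists (f + f'), (g + g'). split; [apply (id_add HI); auto|]. split; [auto|].
        rewrite (rdistr_l HA) by auto. apply (radd_ACA HA); auto.
      - intros c a Hc Ha; apply inIx in Ha; destruct Ha as (f & g & Hf & Hg & ->).
        apply inIx; exists (c * f), (c * g). split; [apply (id_mul HI); auto|]. split; [auto|].
        rewrite (cr_distr HA), (cr_mulA HA); auto. }
    pose proof (id_sub HIx) as IxC. unfold sub in IxC.
    assert (I_Ix : forall a, a ∈ I -> a ∈ Ix).
    { intros a Ha; apply inIx; exists a, (zero A). do 2 (split; [auto|]).
      rewrite (rmul_0_l HA), (radd_0_r HA); auto. }
    destruct (JM (frac_ideal Ix) (frac_ideal_ideal HIx)) as [E|E].
    (* If a/s is in [J], so is a/1, its product with s/1; hence a is in [I], and [J] is contained in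
       the extension of [Ix]. *)
    + intros c Hc. pose proof (id_sub HJ c Hc) as Fc. apply in_fracs in Fc.
      destruct Fc as (a & s & Ha & Hs & ->). apply in_frac_ideal; [exact IxC|].
      exists a, s; split; [|auto]. apply I_Ix, inI; split; [exact Ha|].
      pose proof (id_mul HJ _ _ (frac_in (ms_in Hs) ms_1) Hc) as K.
      rewrite frac_mul in K by auto.
      replace (fr a (one A)) with (fr (s * a) (one A * s)); [exact K|].
      apply frac_ext; [auto..|]. rewrite (rmul_1_r HA), (cr_mul1 HA) by auto. apply (cr_mulC HA); auto.
    + exfalso; apply Nx, inI; split; [exact Hx|]. rewrite <- E.
      apply in_frac_ideal; [exact IxC|]. exists x, (one A); split; [|auto].
      apply inIx; exists (zero A), (one A). split; [apply (id_zero HI)|]. split; [auto|].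
      rewrite (cr_mul1 HA), (cr_add0 HA); auto.
    (* Now 1 = a/s with a in [Ix], that is, u s = u a for some u in S; this element lies in both S
       and [Ix]. *)
    + assert (H : fr (one A) (one A) ∈ frac_ideal Ix).
      { rewrite E; cbn [car localization]; auto. }
      apply in_frac_ideal in H; [|exact IxC]. destruct H as (a & s & Ha & Hs & Ea).
      apply frac_eq in Ea; [|auto..]. destruct Ea as (u & Hu & Eu).
      rewrite (cr_mul1 HA), (rmul_1_r HA) in Eu by auto.
      assert (Ua : u * a ∈ Ix) by (apply (id_mul HIx); auto).
      apply inIx in Ua; destruct Ua as (f & g & Hf & Hg & Efg).
      exists f, g; do 2 (split; [assumption|]). rewrite <- Efg, <- Eu; auto.
Qed.
End Localization.

(** * Choice *)

Section Choice.
Context {M : ZF_model} {R : ring M} (HD : is_domain R) {I A : M} (HA : is_family A I).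
Let HR : is_comm_ring R := dom_comm_ring HD.
Implicit Types a b f g h i m p q t x y T Y J : M.

Lemma in_family_union x : x ∈ family_union A I <-> exists i, i ∈ I /\ x ∈ app A i.
Proof.
  destruct HA as [B HB]. destruct (zf_union (mem_is_ZF M) B) as [c Hc].
  unfold family_union; apply in_sep with (a := c); [definable|].
  intros y (i & Hi & Hy). apply Hc; exists (app A i); split; [apply (fun_app HB Hi) | exact Hy].
Qed.

Definition pairs : M := setof (fun p => exists i a, i ∈ I /\ a ∈ app A i /\ p = opair i a).

Lemma in_pairs p : p ∈ pairs <-> exists i a, i ∈ I /\ a ∈ app A i /\ p = opair i a.
Proof.
  unfold pairs; apply in_sep with (a := cprod I (family_union A I)); [definable|].
  intros q (i & a & Hi & Ha & ->). rewrite opair_in_cprod, in_family_union; eauto.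
Qed.

Lemma opair_in_pairs i a : opair i a ∈ pairs <-> i ∈ I /\ a ∈ app A i.
Proof.
  rewrite in_pairs; split; [|intros []; eauto].
  intros (j & b & Hj & Hb & E); apply opair_inj in E; destruct E; subst; auto.
Qed.

(** By foundation the set [pairs] is not one of its elements, so it serves as an
    additional variable. *)
Definition extra : M := pairs.
Definition indets : M := insert pairs extra.
Local Notation X := indets.
Local Notation Mon := (monomials X).
Local Notation P := (polys R X).

Lemma pairs_X p : p ∈ pairs -> p ∈ X.
Proof. intros; apply in_insert; auto. Qed.

Lemma extra_X : extra ∈ X.
Proof. apply in_insert; auto. Qed.

Hint Resolve pairs_X extra_X : core.

(** T may be infinite and need not be maximal, so exchanging one of its elements is harmless; as a
    subset of [pairs] it never contains [extra]. *)
Definition partial_choice T : Prop :=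
  sub T pairs /\ forall i a b, opair i a ∈ T -> opair i b ∈ T -> a = b.

Definition denoms : M :=
  setof (fun f => f ∈ P /\ forall T, partial_choice T -> ~ in_ideal (R := R) (X := X) T f).

Local Notation in_id := (in_ideal (R := R) (X := X)).

Lemma in_denoms f : f ∈ denoms <-> f ∈ P /\ forall T, partial_choice T -> ~ in_id T f.
Proof.
  unfold denoms; apply in_sep with (a := P);
    [unfold partial_choice, in_ideal, hits; definable | tauto].
Qed.

Lemma denoms_mult : is_mult_subset (poly_ring R X) denoms.
Proof.
  split.
  - intros f Hf; apply in_denoms in Hf; exact (proj1 Hf).
  - apply in_denoms; cbn [one poly_ring]; split; [apply (const_in HR); auto|].
    intros T _ H. destruct (H (mono_one X)) as (t & _ & Ht & N).
    + apply in_supp; split; [auto|].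
      change (poly_const R X (one R)) with (term (R := R) (X := X) (one R) (mono_one X)).
      rewrite (term_eq HR); [apply (dom_nontrivial HD) | apply (rone_in HR) | auto].
    + apply N, mono_one_app, Ht.
  - intros f g Hf Hg; apply in_denoms in Hf, Hg; destruct Hf as [Hf Nf], Hg as [Hg Ng].
    rewrite (poly_rmul HR) by auto. apply in_denoms; split; [auto|].
    intros T HT H. apply (in_ideal_prime HD Hf Hg) in H. destruct H; [eapply Nf | eapply Ng]; eauto.
Qed.

Lemma zero_not_denom : ~ zero (poly_ring R X) ∈ denoms.
Proof.
  intros H; apply in_denoms in H; destruct H as [_ H]. apply (H empty).
  - split; [intros x Hx; destruct (in_empty Hx) | intros i a b Ha; destruct (in_empty Ha)].
  - intros m Hm; apply in_supp in Hm; destruct Hm as [Mm N]. destruct N; apply (const_0_app HR Mm).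
Qed.

Definition var p : M := term (R := R) (X := X) (one R) (mono_pow X p (succ empty)).

Lemma var_in p : var p ∈ P.
Proof. exact (term_in HR (mono_pow X p (succ empty)) (rone_in HR)). Qed.

Lemma hits_pow T p n : sub T X -> n ∈ omega ->
  hits (X := X) T (mono_pow X p n) -> p ∈ T.
Proof.
  intros HT Hn (t & Ht & Hx & N). apply NNPP; intros Np. apply N, mono_pow_neq; auto.
  intros E; congruence.
Qed.

Lemma var_in_ideal T p : p ∈ X -> p ∈ T -> in_id T (var p).
Proof.
  intros Hp HT m Hm. apply in_supp in Hm; destruct Hm as [Mm N].
  assert (m = mono_pow X p (succ empty)) as ->.
  { apply NNPP; intros E; apply N. exact (term_neq HR (rone_in HR) Mm E). }
  exists p; do 2 (split; [assumption|]). rewrite mono_pow_eq by auto. apply succ_neq_0.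
Qed.

(** * The contracted ideal and the choice function it determines *)

Section Contraction.
Context {J : M} (HJ : is_ideal (poly_ring R X) J)
  (HJS : forall f, f ∈ denoms -> ~ f ∈ J)
  (HJM : forall x, x ∈ P -> ~ x ∈ J -> exists f g, f ∈ J /\ g ∈ P /\
     radd (poly_ring R X) f (rmul (poly_ring R X) g x) ∈ denoms).

Lemma J_in f : f ∈ J -> f ∈ P.
Proof. exact (id_sub HJ f). Qed.

Hint Resolve J_in var_in : core.

Lemma J_add f g : f ∈ J -> g ∈ J -> poly_add R X f g ∈ J.
Proof. intros Hf Hg; rewrite <- (poly_radd HR) by auto. apply (id_add HJ); assumption. Qed.

Lemma J_mul f g : f ∈ P -> g ∈ J -> poly_mul R X f g ∈ J.
Proof. intros Hf Hg; rewrite <- (poly_rmul HR) by auto. apply (id_mul HJ); assumption. Qed.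

Lemma J_choice f : f ∈ J -> exists T, partial_choice T /\ in_id T f.
Proof.
  intros Hf; apply NNPP; intros N. apply (@HJS f); [|exact Hf].
  apply in_denoms; split; [auto|]. intros T HT H; apply N; eauto.
Qed.

(** A high power of the extra variable, which lies outside all the ideals
    considered, keeps the monomials of [f] and [g] apart. *)
Lemma J_combine f g : f ∈ J -> g ∈ J -> exists h, h ∈ J /\
  forall T, partial_choice T -> in_id T h -> in_id T f /\ in_id T g.
Proof.
  intros Hf Hg. pose proof (J_in Hf) as Pf. pose proof (J_in Hg) as Pg.
  destruct (@finite_bound M (fun m => app m extra) (supp R X f)) as (n & Hn & HB).
  { definable. }
  { auto. }
  { intros m Hm; apply (mono_app (supp_mono Hm) extra_X). }
  pose proof (mono_pow_in (X := X) extra Hn) as Mw. set (w := mono_pow X extra n) in *.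
  pose proof (term_in HR (X := X) w (rone_in HR)) as Pt.
  set (t := term (R := R) (X := X) (one R) w) in *.
  pose proof (poly_mul_in HR Pt Pg) as Ptg.
  exists (poly_add R X f (poly_mul R X t g)); split.
  { apply J_add; [exact Hf | apply J_mul; assumption]. }
  (* By the choice of n, no monomial of f is a multiple of [w]. Therefore f + w g has the
     coefficients of f on the support of f, and at [w m] the coefficient of g at m. *)
  assert (Hw : forall m, m ∈ Mon -> ~ mono_mul X w m ∈ supp R X f).
  { intros m Mm Hm. apply (HB _ (app m extra) Hm); [exact (mono_app Mm extra_X)|].
    rewrite mono_mul_app by auto. unfold w; rewrite mono_pow_eq by auto. reflexivity. }
  intros T HT H. split; intros m Hm; pose proof (supp_mono Hm) as Mm.
  - apply H, in_supp; split; [exact Mm|]. rewrite (poly_add_app HR) by assumption.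
    unfold t; rewrite (term_mul_app_0 HR); [|apply (rone_in HR)|assumption..|].
    + rewrite (radd_0_r HR) by (apply (coef_in Pf Mm)). apply in_supp in Hm; tauto.
    + intros b Hb ->. exact (Hw b Hb Hm).
  - assert (Hh : hits (X := X) T (mono_mul X w m)).
    { apply H, in_supp; split; [auto|]. rewrite (poly_add_app HR) by auto.
      rewrite (@coef_0 M R X f) by auto.
      unfold t; rewrite (term_mul_app HR) by (try apply (rone_in HR); assumption).
      pose proof (coef_in Pg Mm) as Cg.
      rewrite (cr_mul1 HR), (cr_add0 HR) by exact Cg. apply in_supp in Hm; tauto. }
    (* The variable of T that occurs in [w m] cannot come from [w], since T consists of pairs; so it
       occurs in m. *)
    apply hits_mul in Hh; [|assumption..]. destruct Hh as [Hh|Hh]; [|exact Hh].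
    apply hits_pow in Hh; [|intros x Hx; apply pairs_X, HT, Hx | exact Hn].
    apply (proj1 HT) in Hh. destruct (not_in_self Hh).
Qed.

Lemma J_functional i a b : opair i a ∈ pairs -> opair i b ∈ pairs ->
  var (opair i a) ∈ J -> var (opair i b) ∈ J -> a = b.
Proof.
  intros Ha Hb Ja Jb. destruct (J_choice (J_add Ja Jb)) as (T & HT & H).
  (* Assuming a and b distinct makes the two monomials distinct, so neither coefficient of the sum
     is affected by the other. Both variables must then lie in T, which is functional. *)
  apply NNPP; intros N. apply N. apply (proj2 HT i).
  all: assert (XT : sub T X) by (intros x Hx; apply pairs_X, HT, Hx).
  all: assert (W1 : succ (@empty M) ∈ omega) by auto.
  all: assert (NE : mono_pow X (opair i a) (succ empty) <> mono_pow X (opair i b) (succ empty)).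
  1, 3: intros E; apply (f_equal (fun m => app m (opair i a))) in E;
    rewrite mono_pow_eq, mono_pow_neq in E by
      (auto; intros E'; apply opair_inj in E'; tauto); exact (succ_neq_0 E).
  - apply (hits_pow XT W1), H, in_supp. split; [auto|].
    rewrite (poly_add_app HR) by auto. unfold var.
    rewrite (term_eq HR), (term_neq HR), (radd_0_r HR) by (auto; apply (rone_in HR)).
    apply (dom_nontrivial HD).
  - apply (hits_pow XT W1), H, in_supp. split; [auto|].
    rewrite (poly_add_app HR) by auto. unfold var.
    rewrite (term_eq HR), (term_neq HR), (cr_add0 HR) by (auto; apply (rone_in HR)).
    apply (dom_nontrivial HD).
Qed.

(** Maximality gives f + g p in S with f in J. If T contained p and (T) contained f, then (T) would
    contain f + g p, contrary to the definition of S. *)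
Lemma J_excludes p : p ∈ X -> ~ var p ∈ J ->
  exists f, f ∈ J /\ forall T, partial_choice T -> p ∈ T -> ~ in_id T f.
Proof.
  intros Hp Np. destruct (HJM (var_in p) Np) as (f & g & Hf & Hg & Hs).
  exists f; split; [exact Hf|]. intros T HT Tp H.
  rewrite (poly_rmul HR), (poly_radd HR) in Hs by auto.
  apply in_denoms in Hs; destruct Hs as [_ Hs]. apply (Hs T HT).
  apply (in_ideal_add HD); auto. apply (in_ideal_mul HD); auto. apply var_in_ideal; assumption.
Qed.

(** One element of J handles all of [Y]: each induction step combines it with one polynomial from
    [J_excludes]. The induction claims existence only, so no function from y to such polynomials is
    ever chosen. *)
Lemma J_avoids Y : finite Y -> (forall y, y ∈ Y -> y ∈ X /\ ~ var y ∈ J) ->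
  exists h, h ∈ J /\ forall T, partial_choice T -> in_id T h -> forall y, y ∈ Y -> ~ y ∈ T.
Proof.
  revert Y; apply (@finite_ind M (fun Y => (forall y, y ∈ Y -> y ∈ X /\ ~ var y ∈ J) ->
    exists h, h ∈ J /\ forall T, partial_choice T -> in_id T h -> forall y, y ∈ Y -> ~ y ∈ T)).
  - unfold partial_choice, in_ideal, hits, var, term, ite, mono_pow, ite; definable.
  - intros _; exists (zero (poly_ring R X)); split; [exact (id_zero HJ)|].
    intros T _ _ y Hy; destruct (in_empty Hy).
  - intros Y y _ _ IH H. destruct IH as (h & Hh & K).
    { intros z Hz; apply H, in_insert; auto. }
    destruct (H y) as [Xy Ny]; [apply in_insert; auto|].
    destruct (J_excludes Xy Ny) as (f & Hf & Kf).
    destruct (J_combine Hh Hf) as (k & Hk & Kk).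
    exists k; split; [exact Hk|]. intros T HT HTk z Hz Tz. destruct (Kk T HT HTk) as [Th Tf].
    apply in_insert in Hz; destruct Hz as [Hz| ->]; [exact (K T HT Th z Hz Tz)|].
    exact (Kf T HT Tz Tf).
Qed.

Lemma J_total i : i ∈ I -> (exists a, a ∈ app A i) ->
  exists a, a ∈ app A i /\ var (opair i a) ∈ J.
Proof.
  intros Hi [a0 Ha0]. apply NNPP; intros N.
  assert (N' : forall a, a ∈ app A i -> ~ var (opair i a) ∈ J) by eauto.
  assert (Hx : opair i a0 ∈ pairs) by (apply opair_in_pairs; auto).
  destruct (J_excludes (pairs_X Hx) (N' a0 Ha0)) as (f & Hf & Kf).
  destruct (@finite_bigcup M (fun m => vars X m) (supp R X f)) as (V & FV & HV).
  { unfold vars; definable. }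
  { auto. }
  { intros m Hm; apply supp_mono, in_monomials in Hm; tauto. }
  (* [Y] collects the variables above i that occur in f. It is finite even if [app A i] is not. *)
  assert (HY : forall y, y ∈ setof (fun y => y ∈ V /\ exists a, a ∈ app A i /\ y = opair i a) <->
    y ∈ V /\ exists a, a ∈ app A i /\ y = opair i a).
  { apply in_sep with (a := V); [definable | tauto]. }
  set (Y := setof _) in HY. clearbody Y.
  destruct (@J_avoids Y) as (h & Hh & Kh).
  { apply finite_sub with (B := V); [exact FV|]. intros y Hy; apply HY in Hy; tauto. }
  { intros y Hy; apply HY in Hy; destruct Hy as (_ & a & Ha & ->).
    split; [apply pairs_X, opair_in_pairs; auto | auto]. }
  destruct (J_combine Hf Hh) as (k & Hk & Kk).
  destruct (J_choice Hk) as (T & HT & HTk). destruct (Kk T HT HTk) as [Tf Th].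
  pose proof (Kh T HT Th) as NY.
  (* [T'] is T with any element above i discarded and (i, a0) put in its place; the discarding keeps
     it functional. *)
  assert (HT' : forall t,
    t ∈ setof (fun t => (t ∈ T /\ ~ (exists a, t = opair i a)) \/ t = opair i a0) <->
    (t ∈ T /\ ~ (exists a, t = opair i a)) \/ t = opair i a0).
  { apply in_sep with (a := insert T (opair i a0)); [definable|].
    intros t; rewrite in_insert; tauto. }
  set (T' := setof _) in HT'. clearbody T'.
  apply (Kf T').
  - split.
    + intros t Ht; apply HT' in Ht; destruct Ht as [[Ht _]| ->]; [apply (proj1 HT), Ht | exact Hx].
    + intros j b c Hb Hc; apply HT' in Hb, Hc.
      destruct Hb as [[Hb Nb]|Eb], Hc as [[Hc Nc]|Ec].
      * exact (proj2 HT j b c Hb Hc).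
      * apply opair_inj in Ec; destruct Ec; subst. destruct Nb; eauto.
      * apply opair_inj in Eb; destruct Eb; subst. destruct Nc; eauto.
      * apply opair_inj in Eb, Ec; destruct Eb, Ec; congruence.
  - apply HT'; auto.
  (* The variable of T that occurs in m cannot lie above i, since it would then belong to [Y], which
     T avoids; so it survives in [T'], and f stays in the ideal, contradicting [Kf]. *)
  - intros m Hm. destruct (Tf m Hm) as (t & Ht & Xt & Nt). exists t; split; [|auto].
    apply HT'; left; split; [exact Ht|]. intros [a ->].
    apply (NY (opair i a)); [|exact Ht]. apply HY; split.
    + apply HV; exists m; split; [exact Hm | apply in_vars; auto].
    + apply (proj1 HT), opair_in_pairs in Ht. exists a; tauto.
Qed.

Lemma choice_function : (forall i, i ∈ I -> exists x, x ∈ app A i) ->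
  exists f, is_fun f I (family_union A I) /\ forall i, i ∈ I -> app f i ∈ app A i.
Proof.
  intros NE.
  assert (Hc : forall p, p ∈ setof (fun p => p ∈ pairs /\ var p ∈ J) <-> p ∈ pairs /\ var p ∈ J).
  { apply in_sep with (a := pairs); [|tauto].
    unfold var, term, mono_pow, ite; definable. }
  set (c := setof _) in Hc. clearbody c.
  assert (Fc : is_fun c I (family_union A I)).
  { split.
    - intros p Hp; apply Hc in Hp; destruct Hp as [Hp _]. apply in_pairs in Hp.
      destruct Hp as (i & a & Hi & Ha & ->). apply opair_in_cprod; rewrite in_family_union; eauto.
    - intros i Hi. destruct (J_total Hi (NE i Hi)) as (a & Ha & Ja).
      assert (Pa : opair i a ∈ pairs) by (apply opair_in_pairs; auto).
      exists a; split; [apply Hc; auto|]. intros b Hb; apply Hc in Hb; destruct Hb as [Pb Jb].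
      exact (J_functional Pa Pb Ja Jb). }
  exists c; split; [exact Fc|]. intros i Hi. pose proof (fun_graph Fc Hi) as H.
  apply Hc in H; destruct H as [H _]. apply opair_in_pairs in H; tauto.
Qed.
End Contraction.
End Choice.

Theorem theorem1 (M : ZF_model) (R : ring M)
  (R_domain : is_domain R)
  (R_max : forall X S : M,
     is_mult_subset (poly_ring R X) S ->
     ~ (zero (poly_ring R X) ∈ S) ->
     exists J : M, is_maximal_ideal (localization (poly_ring R X) S) J) :
  forall I A : M,
    is_family A I ->
    (forall i, i ∈ I -> exists x, x ∈ app A i) ->
    exists f : M,
      is_fun f I (family_union A I) /\
      forall i, i ∈ I -> app f i ∈ app A i.
Proof.
  intros I A HA NE.
  pose proof (denoms_mult (I := I) (A := A) R_domain) as HS.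
  destruct (R_max _ _ HS (zero_not_denom R_domain)) as [L HL].
  destruct (maximal_contraction (poly_comm_ring (dom_comm_ring R_domain)) HS HL)
    as (J & HJ & HJS & HJM).
  exact (choice_function R_domain HA HJ HJS HJM NE).
Qed.
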